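(* Let $n$ be a positive integer and let $D$ be a function from the family of compact subsets of $\mathbb{R}^n$ to $[0,n]$. Suppose that (i) Lipschitz functions cannot increase $D$, that is, for any compact $K\subset\mathbb{R}^n$ and Lipschitz function $f\colon K\to\mathbb{R}^n$ we have $D(f(K))\le D(K)$; (ii) $D$ is monotone, that is, $A\subset B$ implies $D(A)\le D(B)$; and (iii) if $S\subset\mathbb{R}^n$ is a homogeneous self-similar set with the strong separation condition (SSC), then $D(S)=\dim_H S$. Then for every compact set $K\subset\mathbb{R}^n$ we have $$\dim_H K\le D(K)\le\overline{\dim}_B K.$$ Furthermore, if we also require that $D$ is $\sigma$-stable, that is, (iv) $D\left(\bigcup_{i=1}^\infty K_i\right)=\sup_i D(K_i)$ whenever $\bigcup_{i=1}^\infty K_i$ and all $K_i$ are compact, then for every compact set $K\subset\mathbb{R}^n$ we have $$\dim_H K\le D(K)\le\dim_P K.$$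
   Context: $\dim_H$ denotes Hausdorff dimension. For a bounded set $X\subset\mathbb{R}^n$ and $r>0$ let $N(X,r)$ be the minimal number of closed balls of radius $r$ (centered in $X$) that cover $X$; the upper box dimension is $\overline{\dim}_B X=\limsup_{r\to0+}\frac{\log N(X,r)}{\log(1/r)}$. The packing dimension of $X\subset\mathbb{R}^n$ is $\dim_P X=\inf\{\sup_i\overline{\dim}_B X_i: X=\bigcup_{i=1}^\infty X_i,\ X_i\text{ bounded}\}$. All these dimensions of the empty set are taken to be $0$. A self-similar set is a nonempty compact $K\subset\mathbb{R}^n$ with $K=\bigcup_{i=1}^m f_i(K)$ for finitely many contracting similarity maps $f_1,\dots,f_m$ of $\mathbb{R}^n$; it satisfies the SSC if $f_i(K)\cap f_j(K)=\emptyset$ for all $1\le i<j\le m$, and it is homogeneous if all the maps $f_i$ have the same similarity ratio. *)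

(* Defs.v *)
From HB Require Import structures.
From mathcomp Require Import all_boot all_order all_algebra.
From mathcomp Require Import all_classical all_reals all_analysis.
Set Implicit Arguments.
Unset Strict Implicit.
Unset Printing Implicit Defensive.
Import Order.TTheory GRing.Theory Num.Theory.
Import numFieldNormedType.Exports.
Local Open Scope classical_set_scope.
Local Open Scope ring_scope.

(* The norm carried by 'rV[R]_n in the library is the maximum norm; similarities,
   balls, diameters and Lipschitz maps below are taken with respect to the
   Euclidean distance.  The topology and the bounded sets are the same for both
   norms, so the library's [compact] and [bounded_set] are used as they are. *)
Definition eucl_dist (R : realType) (n : nat) (x y : 'rV[R]_n) : R :=
  Num.sqrt (\sum_(i < n) (x 0 i - y 0 i) ^+ 2).

Definition eucl_closed_ball (R : realType) (n : nat) (c : 'rV[R]_n) (r : R) :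
    set 'rV[R]_n :=
  [set x | eucl_dist c x <= r].

(* [f] matters only on [K]. *)
Definition eucl_lipschitz_on (R : realType) (n : nat) (K : set 'rV[R]_n)
    (f : 'rV[R]_n -> 'rV[R]_n) : Prop :=
  exists L : R, forall x y, K x -> K y ->
    eucl_dist (f x) (f y) <= L * eucl_dist x y.

(* Equal to -oo on the empty set. *)
Definition diam (R : realType) (n : nat) (U : set 'rV[R]_n) : \bar R :=
  ereal_sup [set (eucl_dist p.1 p.2)%:E | p in U `*` U].

(* (diam U)^s; the empty set contributes 0 for every s, and 0 `^ 0 = 1 makes
   the 0-dimensional measure the counting measure. *)
Definition hausdorff_gauge (R : realType) (n : nat) (s : R)
    (U : set 'rV[R]_n) : \bar R :=
  if U == set0 then 0%E else (diam U `^ s)%E.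

Definition hausdorff_premeasure (R : realType) (n : nat) (s delta : R)
    (X : set 'rV[R]_n) : \bar R :=
  ereal_inf [set (\sum_(0 <= i <oo) hausdorff_gauge s (U i))%E
            | U in [set U : nat -> set 'rV[R]_n |
                    X `<=` \bigcup_i U i /\
                    forall i, (diam (U i) <= delta%:E)%E]].

(* The premeasure is nonincreasing in delta, so its limit at 0 is a supremum. *)
Definition hausdorff_measure (R : realType) (n : nat) (s : R)
    (X : set 'rV[R]_n) : \bar R :=
  ereal_sup [set hausdorff_premeasure s delta X | delta in [set d : R | 0 < d]].

Definition hausdorff_dim (R : realType) (n : nat) (X : set 'rV[R]_n) : \bar R :=
  ereal_inf [set s%:E | s in [set s : R |
    0 <= s /\ hausdorff_measure s X = 0%E]].

(* Least cardinality of a cover of [X] by closed r-balls centered in [X]; +oo if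
   there is no finite one, which does not occur when X is bounded and r > 0. *)
Definition covering_number (R : realType) (n : nat) (X : set 'rV[R]_n) (r : R) :
    \bar R :=
  ereal_inf [set (k%:R)%:E | k in [set k : nat |
    exists c : 'I_k -> 'rV[R]_n, (forall i, X (c i)) /\
      X `<=` \bigcup_i eucl_closed_ball (c i) r]].

(* Meaningful for bounded [X]; the empty set has dimension 0 by convention. *)
Definition upper_box_dim (R : realType) (n : nat) (X : set 'rV[R]_n) : \bar R :=
  if X == set0 then 0%E else
  limf_esup (fun r : R => (lne (covering_number X r) * ((ln r^-1)^-1)%:E)%E)
            (0 : R)^'+.

Definition packing_dim (R : realType) (n : nat) (X : set 'rV[R]_n) : \bar R :=
  ereal_inf [set ereal_sup (range (fun i => upper_box_dim (F i)))
            | F in [set F : nat -> set 'rV[R]_n |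
                    X = \bigcup_i F i /\ forall i, bounded_set (F i)]].

Definition similarity (R : realType) (n : nat) (r : R)
    (f : 'rV[R]_n -> 'rV[R]_n) : Prop :=
  forall x y, eucl_dist (f x) (f y) = r * eucl_dist x y.

Definition contracting_similarity (R : realType) (n : nat)
    (f : 'rV[R]_n -> 'rV[R]_n) : Prop :=
  exists r : R, 0 < r < 1 /\ similarity r f.

Definition self_similar (R : realType) (n m : nat)
    (f : 'I_m -> 'rV[R]_n -> 'rV[R]_n) (K : set 'rV[R]_n) : Prop :=
  [/\ K !=set0, compact K, (forall i, contracting_similarity (f i)) &
      K = \bigcup_i (f i @` K)].

Definition SSC (R : realType) (n m : nat)
    (f : 'I_m -> 'rV[R]_n -> 'rV[R]_n) (K : set 'rV[R]_n) : Prop :=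
  forall i j : 'I_m, (i < j)%N -> (f i @` K) `&` (f j @` K) = set0.

Definition homogeneous (R : realType) (n m : nat)
    (f : 'I_m -> 'rV[R]_n -> 'rV[R]_n) : Prop :=
  exists r : R, forall i, similarity r (f i).

Definition homogeneous_self_similar_SSC (R : realType) (n : nat)
    (K : set 'rV[R]_n) : Prop :=
  exists (m : nat) (f : 'I_m -> 'rV[R]_n -> 'rV[R]_n),
    [/\ self_similar f K, homogeneous f & SSC f K].

(* Main.v *)
Require Import Defs.
From HB Require Import structures.
From mathcomp Require Import all_boot all_order all_algebra.
From mathcomp Require Import all_classical all_reals all_analysis.
From mathcomp Require Import ring lra.
Set Implicit Arguments.
Unset Strict Implicit.
Unset Printing Implicit Defensive.
Import Order.TTheory GRing.Theory Num.Theory.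
Import numFieldNormedType.Exports.
Local Open Scope classical_set_scope.
Local Open Scope ring_scope.

(* If [dim_H A > t] and the box-counting function of [B] is [O(rho^-t)], then [B]
   is a Lipschitz image of a compact subset of [A].  Refine [A] by [b]-adic cubes
   weighted by Hausdorff content; keeping only children whose positions agree
   modulo 2 separates siblings at the price of a factor [2^n] per level, which is
   absorbed by the exponents when [b] is large.  A tree of finite [b^-j]-nets of
   [B] is then assigned greedily to the cubes: a net point receives cubes of total
   weight at least the sum, over its descendants, of the maximal weight of a cube
   of their level; these sums converge because the number of net points grows more
   slowly than the weight of a cube decays.  A branch of cubes determines a point
   of [B], in a Lipschitz way.

   Comparing a compact [K] in both directions with Cantor dusts, homogeneous
   self-similar sets with the SSC of any dimension in (0, n), squeezes [D K]
   between [dim_H K] and the upper box dimension.  For the packing dimension, a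
   decomposition of [K] is replaced by the closures of its pieces. *)

(** * Norms and Hausdorff content *)

Section Norms.
Variables (R : realType) (n : nat).
Implicit Types x y : 'rV[R]_n.

Lemma norm_coord_le x i : `|x 0 i| <= `|x|.
Proof.
rewrite [leRHS]/Num.norm /= mx_normrE; apply/bigmax_geP; right => /=.
by exists (0, i).
Qed.

Lemma norm_le_coord x (r : R) :
  0 <= r -> (forall i, `|x 0 i| <= r) -> `|x| <= r.
Proof.
move=> r0 xr; rewrite [leLHS]/Num.norm /= mx_normrE; apply/bigmax_leP; split=> //.
by move=> [j i] _ /=; rewrite (ord1 j).
Qed.

Lemma norm_le_eucl x y : `|x - y| <= eucl_dist x y.
Proof.
apply: norm_le_coord => [|i]; first exact: sqrtr_ge0.
rewrite !mxE -sqrtr_sqr ler_wsqrtr// (bigD1 i)//= lerDl.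
by apply: sumr_ge0 => j _; exact: sqr_ge0.
Qed.

Lemma eucl_le_norm x y : eucl_dist x y <= n%:R * `|x - y|.
Proof.
rewrite -[leRHS]ger0_norm ?mulr_ge0// -sqrtr_sqr ler_wsqrtr// exprMn.
apply: (@le_trans _ _ (\sum_(i < n) `|x - y| ^+ 2)).
  apply: ler_sum => i _; rewrite -[leLHS]real_normK ?num_real//.
  by rewrite lerXn2r ?nnegrE//; have := norm_coord_le (x - y) i; rewrite !mxE.
rewrite sumr_const card_ord -[leLHS]mulr_natl ler_wpM2r ?sqr_ge0//.
by rewrite -natrX ler_nat; case: (n) => // k; rewrite -mulnn leq_pmulr.
Qed.

Lemma eucl_distxx x : eucl_dist x x = 0.
Proof.
by rewrite /eucl_dist big1 ?sqrtr0// => i _; rewrite subrr expr0n.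
Qed.

End Norms.

Section HausdorffContent.
Variables (R : realType) (n : nat).
Implicit Types (X Y U : set 'rV[R]_n) (s d : R).
Local Open Scope ereal_scope.

Lemma hausdorff_gauge_ge0 s U : 0 <= hausdorff_gauge s U.
Proof. by rewrite /hausdorff_gauge; case: ifP => // _; exact: poweR_ge0. Qed.

Lemma diam0 : diam (set0 : set 'rV[R]_n) = -oo.
Proof. by rewrite /diam; apply/ereal_sup_ninfty => y [p [] []]. Qed.

Lemma diam_ge0 U : U !=set0 -> 0 <= diam U.
Proof.
move=> [x Ux]; apply: ereal_sup_ubound; exists (x, x) => //=.
by rewrite eucl_distxx.
Qed.

Lemma diam_le U d :
  (forall x y, U x -> U y -> (eucl_dist x y <= d)%R) -> diam U <= d%:E.
Proof.
by move=> Ud; apply: ge_ereal_sup => _ [[x y] [/= Ux Uy] <-]; rewrite lee_fin Ud.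
Qed.

Lemma eucl_le_diam U x y : U x -> U y -> (eucl_dist x y)%:E <= diam U.
Proof. by move=> Ux Uy; apply: ereal_sup_ubound; exists (x, y). Qed.

Lemma hausdorff_gauge_le s U d : (0 <= s)%R -> (0 <= d)%R ->
  diam U <= d%:E -> hausdorff_gauge s U <= (d `^ s)%:E.
Proof.
move=> s0 d0 Ud; rewrite /hausdorff_gauge; case: ifPn => [_|/set0P U0].
  by rewrite lee_fin powR_ge0.
rewrite -poweR_EFin; apply: gt0_ler_poweR => //.
  by rewrite in_itv/= diam_ge0//= leey.
by rewrite in_itv/= lee_fin d0 leey.
Qed.

Lemma hausdorff_premeasure_ge0 s d X : 0 <= hausdorff_premeasure s d X.
Proof.
apply: le_ereal_inf_tmp => _ [U _ <-]; apply: nneseries_ge0 => i _ _.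
exact: hausdorff_gauge_ge0.
Qed.

Lemma hausdorff_premeasureS s d X Y : X `<=` Y ->
  hausdorff_premeasure s d X <= hausdorff_premeasure s d Y.
Proof.
move=> XY; apply: ereal_inf_le_tmp => _ [U [YU Ud] <-]; exists U => //.
by split=> //; exact: subset_trans YU.
Qed.

(** Pad [U] with empty sets: their diameter [-oo] is admissible at every scale and their gauge is
    [0]. *)
Lemma hausdorff_premeasure_le_gauge s d X U : X `<=` U -> diam U <= d%:E ->
  hausdorff_premeasure s d X <= hausdorff_gauge s U.
Proof.
move=> XU Ud; apply: ereal_inf_lbound.
exists (fun i : nat => if i == 0%N then U else set0).
  split=> [x /XU Ux|[|i]//]; first by exists 0%N.
  by rewrite diam0 leNye.
rewrite (@nneseriesD1 R _ 0%N xpredT)//=; last first.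
  by move=> i _; exact: hausdorff_gauge_ge0.
rewrite eseries0 ?adde0// => -[|i]//= _ _.
by rewrite /hausdorff_gauge eqxx.
Qed.

Lemma hausdorff_premeasure0 s d : hausdorff_premeasure s d (set0 : set 'rV[R]_n) = 0.
Proof.
apply/eqP; rewrite eq_le hausdorff_premeasure_ge0 andbT.
have := @hausdorff_premeasure_le_gauge s d set0 set0.
by rewrite /hausdorff_gauge eqxx diam0 leNye; apply.
Qed.

(** Interleave a cover of [X] and a cover of [Y], each optimal up to [e / 2]. *)
Lemma hausdorff_premeasureU s d X Y :
  hausdorff_premeasure s d (X `|` Y) <=
  hausdorff_premeasure s d X + hausdorff_premeasure s d Y.
Proof.
set hX := hausdorff_premeasure s d X; set hY := hausdorff_premeasure s d Y.
have [hXoo|hXoo] := eqVneq hX +oo.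
  by rewrite hXoo addye ?leey// -ltNye (lt_le_trans _ (hausdorff_premeasure_ge0 _ _ _)).
have [hYoo|hYoo] := eqVneq hY +oo.
  by rewrite hYoo addey ?leey// -ltNye (lt_le_trans _ (hausdorff_premeasure_ge0 _ _ _)).
have fX : hX \is a fin_num.
  by rewrite ge0_fin_numE ?hausdorff_premeasure_ge0// ltey.
have fY : hY \is a fin_num.
  by rewrite ge0_fin_numE ?hausdorff_premeasure_ge0// ltey.
apply/lee_addgt0Pr => e e0.
have e20 : (0 < e / 2)%R by rewrite divr_gt0.
have [_ [U [XU Ud] <-] Us] := lb_ereal_inf_adherent e20 fX.
have [_ [V [YV Vd] <-] Vs] := lb_ereal_inf_adherent e20 fY.
apply: (@le_trans _ _ (\sum_(0 <= i <oo) hausdorff_gauge s (U i) +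
                       \sum_(0 <= i <oo) hausdorff_gauge s (V i))); last first.
  rewrite [e%:E](_ : _ = (e / 2)%:E + (e / 2)%:E); last by rewrite -EFinD -splitr.
  by rewrite addeACA; apply: leeD; exact: ltW.
pose W i := if odd i then V i./2 else U i./2.
have W0 i : 0 <= hausdorff_gauge s (W i) by exact: hausdorff_gauge_ge0.
apply: (@le_trans _ _ (\sum_(0 <= i <oo) hausdorff_gauge s (W i))).
  apply: ereal_inf_lbound; exists W => //; split.
    move=> x [/XU [i _ Ui]|/YV [i _ Vi]].
      by exists i.*2 => //; rewrite /W odd_double doubleK.
    by exists i.*2.+1 => //; rewrite /W /= odd_double /= uphalf_double.
  by move=> i; rewrite /W; case: ifP.
apply: lime_le; first exact: is_cvg_nneseries.
apply: nearW => N.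
have UN := @nneseries_lim_ge R (fun i => hausdorff_gauge s (U i)) xpredT 0%N N
  (fun i _ _ => hausdorff_gauge_ge0 s (U i)).
have VN := @nneseries_lim_ge R (fun i => hausdorff_gauge s (V i)) xpredT 0%N N
  (fun i _ _ => hausdorff_gauge_ge0 s (V i)).
apply: le_trans (leeD UN VN).
(* The first [N.*2] terms of [W] are exactly the first [N] of [U] and of [V], and they dominate its
   first [N] terms. *)
have -> : \sum_(0 <= i < N) hausdorff_gauge s (U i) +
          \sum_(0 <= i < N) hausdorff_gauge s (V i) =
          \sum_(0 <= i < N.*2) hausdorff_gauge s (W i).
  elim: (N) => [|k IH]; first by rewrite !big_geq ?adde0.
  rewrite doubleS !big_nat_recr//= -IH /W /= odd_double /= uphalf_double doubleK.
  by rewrite addeACA addeA.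
rewrite -addnn [leRHS](big_cat_nat _ (n := N))//= ?leq_addr// leeDl//.
by apply: sume_ge0.
Qed.

Lemma hausdorff_premeasure_bigcup s d (I : Type) (l : seq I)
    (F : I -> set 'rV[R]_n) X :
  X `<=` \big[setU/set0]_(i <- l) F i ->
  hausdorff_premeasure s d X <= \sum_(i <- l) hausdorff_premeasure s d (F i).
Proof.
move=> /hausdorff_premeasureS XF; apply: le_trans (XF s d) _.
elim: l {XF} => [|i l IH]; first by rewrite !big_nil hausdorff_premeasure0.
by rewrite !big_cons; apply: le_trans (hausdorff_premeasureU _ _ _ _) _; rewrite leeD.
Qed.

Lemma hausdorff_premeasure_le s d X (a : R) : (0 <= s)%R -> (0 <= a)%R ->
  (n%:R * a <= d)%R -> (forall x y, X x -> X y -> (`|x - y| <= a)%R) ->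
  hausdorff_premeasure s d X <= ((n%:R * a) `^ s)%:E.
Proof.
move=> s0 a0 nad Xa.
have na0 : (0 <= n%:R * a)%R by rewrite mulr_ge0.
have Xna : diam X <= (n%:R * a)%:E.
  apply: diam_le => x y Xx Xy; apply: le_trans (eucl_le_norm x y) _.
  by rewrite ler_wpM2l// Xa.
apply: le_trans (hausdorff_gauge_le s0 na0 Xna).
by apply: hausdorff_premeasure_le_gauge => //; rewrite (le_trans Xna)// lee_fin.
Qed.

(** If every premeasure of exponent [s] vanished, [s] would compete in the infimum. Fixing one scale
    [d] is useful because small cubes have finite content there, which the Hausdorff measure does
    not guarantee. *)
Lemma hausdorff_dim_gt s X : (0 <= s)%R -> s%:E < hausdorff_dim X ->
  exists2 d, (0 < d)%R & 0 < hausdorff_premeasure s d X.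
Proof.
move=> s0 sX; apply: contrapT => noX.
have : hausdorff_dim X <= s%:E; last by rewrite leNgt sX.
apply: ereal_inf_lbound; exists s => //=; split=> //.
apply/eqP; rewrite eq_le; apply/andP; split.
  apply: ge_ereal_sup => _ [d /= d0 <-]; rewrite leNgt; apply/negP => h.
  by apply: noX; exists d.
apply: le_trans (hausdorff_premeasure_ge0 s 1 X) _.
by apply: ereal_sup_ubound; exists 1%R => //=.
Qed.

End HausdorffContent.

(** * Weighted trees *)

Section TreeAssignment.
Variable R : realType.

Lemma cvg_sum_seq (I : Type) (r : seq I) (P : pred I) (f : I -> nat -> R)
    (l : I -> R) :
  (forall i, P i -> f i k @[k --> \oo] --> l i) ->
  \sum_(i <- r | P i) f i k @[k --> \oo] --> \sum_(i <- r | P i) l i.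
Proof.
move=> fl; elim: r => [|i r IH].
  by under eq_fun do rewrite big_nil; rewrite big_nil; exact: cvg_cst.
under eq_fun do rewrite big_cons; rewrite big_cons; case: ifPn => // Pi.
by apply: cvgD => //; exact: fl.
Qed.

(* The limit of these truncated sums is [2 M_j] plus the weights of the children,
   i.e. twice the sum of [M] over all descendants of [u], [u] included. *)
Fixpoint truncated_weight (N : nat -> nat) (p : nat -> nat -> nat) (M : nat -> R)
    (k j u : nat) : R :=
  2 * M j + (if k is k'.+1 then
    \sum_(0 <= v < N j.+1 | p j v == u) truncated_weight N p M k' j.+1 v else 0).

(** [w] is the limit of the truncated weights, nondecreasing in the depth and bounded by geometric
    decay. Of the two copies of [M j], one pays for the loss in a greedy step and the other keeps
    the remainder positive. *)
Lemma tree_weights (N : nat -> nat) (p : nat -> nat -> nat) (M : nat -> R)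
    (K q : R) :
  (forall j u, (u < N j.+1)%N -> (p j u < N j)%N) ->
  (forall j, 0 <= M j) -> 0 <= K -> 0 <= q <= 2^-1 ->
  (forall j, (N j)%:R * M j <= K * q ^+ j) ->
  exists w : nat -> nat -> R,
    [/\ forall j u, 0 <= w j u,
        forall j u, (u < N j)%N ->
          2 * M j + \sum_(0 <= v < N j.+1 | p j v == u) w j.+1 v <= w j u &
        \sum_(0 <= u < N 0%N) w 0%N u <= 4 * K].
Proof.
move=> pN M0 K0 /andP[q0 q1] NM.
pose W := truncated_weight N p M.
have WE k j u : W k j u = 2 * M j + (if k is k'.+1 then
    \sum_(0 <= v < N j.+1 | p j v == u) W k' j.+1 v else 0) by case: k.
have W0 k j u : 0 <= W k j u.
  elim: k j u => [|k IH] j u; rewrite WE; first by rewrite addr0 mulr_ge0.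
  by rewrite addr_ge0 ?mulr_ge0 ?sumr_ge0.
have WS k j u : W k j u <= W k.+1 j u.
  elim: k j u => [|k IH] j u; rewrite WE [leRHS]WE lerD2l; first exact: sumr_ge0.
  exact: ler_sum.
(* The level itself takes [2 * K * q ^+ j]; its children take [4 * K * q ^+ j.+1], at most as much
   again since [q <= 2^-1]. *)
have Wsum k j : \sum_(0 <= u < N j) W k j u <= 4 * K * q ^+ j.
  elim: k j => [|k IH] j.
    under eq_bigr do rewrite WE addr0.
    rewrite sumr_const_nat subn0 -mulr_natl.
    have := NM j; have : 0 <= K * q ^+ j by rewrite mulr_ge0// exprn_ge0.
    lra.
  under eq_bigr do rewrite WE.
  rewrite big_split/= sumr_const_nat subn0 -mulr_natl.
  (* Each [v] has a single parent, which lies below [N j], so the double sum collapses. *)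
  have -> : \sum_(0 <= u < N j) \sum_(0 <= v < N j.+1 | p j v == u) W k j.+1 v =
            \sum_(0 <= v < N j.+1) W k j.+1 v.
    rewrite (exchange_big_dep_nat xpredT)//= big_nat [RHS]big_nat.
    apply: eq_bigr => v /andP[_ vN].
    rewrite (big_rem (p j v)) ?mem_index_iota ?pN//= eqxx big1_seq ?addr0// => u.
    by move=> /andP[/eqP <-]; rewrite mem_rem_uniqF ?iota_uniq.
  have := NM j; have := IH j.+1; rewrite exprS.
  have : q * (K * q ^+ j) <= 2^-1 * (K * q ^+ j).
    by rewrite ler_wpM2r// mulr_ge0// exprn_ge0.
  lra.
have Wub k j u : (u < N j)%N -> W k j u <= 4 * K * q ^+ j.
  move=> uN; apply: le_trans (Wsum k j).
  by rewrite (big_rem u) ?mem_index_iota//= lerDl sumr_ge0.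
pose w j u := limn (fun k => W k j u).
have Wnd j u : nondecreasing_seq (fun k => W k j u).
  by apply/nondecreasing_seqP => k.
have Wcvg j u : (u < N j)%N -> W k j u @[k --> \oo] --> w j u.
  move=> uN; apply: nondecreasing_is_cvgn => //.
  by exists (4 * K * q ^+ j) => _ [k _ <-]; exact: Wub.
have Wsumcvg j P : \sum_(0 <= u < N j | P u) W k j u @[k --> \oo] -->
    \sum_(0 <= u < N j | P u) w j u.
  under eq_fun do rewrite big_seq_cond; rewrite big_seq_cond.
  apply: cvg_sum_seq => u; rewrite mem_index_iota => /andP[/andP[_ uN] _].
  exact: Wcvg.
(* Past [N j] the value is set to [0]: convergence was shown only inside the level. *)
exists (fun j u => if (u < N j)%N then w j u else 0); split.
- move=> j u; case: ifPn => // uN.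
  apply: limr_ge; first exact: cvgP (Wcvg j u uN).
  exact: nearW.
- move=> j u uN; rewrite uN.
  have -> : \sum_(0 <= v < N j.+1 | p j v == u)
       (if (v < N j.+1)%N then w j.+1 v else 0) =
      \sum_(0 <= v < N j.+1 | p j v == u) w j.+1 v.
    by rewrite big_nat_cond [RHS]big_nat_cond; apply: eq_bigr => v /andP[/andP[_ ->]].
  have h := Wsumcvg j.+1 (fun v => p j v == u).
  have h2 : 2 * M j + \sum_(0 <= v < N j.+1 | p j v == u) W k j.+1 v @[k --> \oo]
      --> 2 * M j + \sum_(0 <= v < N j.+1 | p j v == u) w j.+1 v.
    by apply: cvgD => //; exact: cvg_cst.
  rewrite -(cvg_lim _ h2)//; apply: limr_le.
    exact: cvgP h2.
  apply: nearW => k /=; apply: (@le_trans _ _ (W k.+1 j u)); first by rewrite WE.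
  apply: (nondecreasing_cvgn_le (Wnd j u)).
  exact: cvgP (Wcvg _ _ uN).
- have -> : \sum_(0 <= u < N 0%N) (if (u < N 0%N)%N then w 0%N u else 0) =
      \sum_(0 <= u < N 0%N) w 0%N u.
    by rewrite big_nat [RHS]big_nat; apply: eq_bigr => v /andP[_ ->].
  have h := Wsumcvg 0%N xpredT.
  rewrite -(cvg_lim _ h)//; apply: limr_le; first exact: cvgP h.
  by apply: nearW => k /=; have := Wsum k 0%N; rewrite expr0 mulr1.
Qed.

(** Take elements while they fit; the one that overflows weighs at most [M], which bounds the
    shortfall. *)
Lemma split_prefix (I : eqType) (h : I -> R) (M : R) (s : seq I) (d : R) :
  0 <= M -> (forall x, x \in s -> h x <= M) -> 0 <= d <= \sum_(x <- s) h x ->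
  exists s1 s2, [/\ s = s1 ++ s2, d - M <= \sum_(x <- s1) h x &
    \sum_(x <- s1) h x <= d].
Proof.
move=> M0; elim: s d => [|x s IH] d hM /andP[d0 ds].
  exists [::], [::]; split => //; rewrite big_nil//.
  by move: ds; rewrite big_nil; lra.
have [hxd|dhx] := leP (h x) d; last first.
  exists [::], (x :: s); split=> //; rewrite big_nil//.
  by have := hM x (mem_head _ _); lra.
have [||s1 [s2 [-> h1 h2]]] := IH (d - h x).
- by move=> y ys; apply: hM; rewrite inE ys orbT.
- by move: ds; rewrite big_cons => ds; apply/andP; split; lra.
by exists (x :: s1), s2; split; rewrite ?big_cons//; lra.
Qed.

(** Each demand in turn takes a prefix of what is left. It takes no more than [d u], so the
    remaining supply still covers the remaining demands; [None] marks leftovers. *)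
Lemma greedy_assignment (I : eqType) (h : I -> R) (M : R) (s : seq I)
    (ds : seq nat) (d : nat -> R) :
  0 <= M -> uniq s -> uniq ds ->
  (forall x, 0 <= h x) -> (forall x, x \in s -> h x <= M) ->
  (forall u, 0 <= d u) -> \sum_(u <- ds) d u <= \sum_(x <- s) h x ->
  exists g : I -> option nat, (forall x u, g x = Some u -> u \in ds) /\
    forall u, u \in ds -> d u - M <= \sum_(x <- s | g x == Some u) h x.
Proof.
move=> M0 + + h0 + d0; elim: ds s => [|u ds IH] s us uds hM.
  by exists (fun=> None).
rewrite big_cons => dsh.
have [|s1 [s2 [sE ds1 s1d]]] := @split_prefix I h M s (d u) M0 hM.
  by rewrite d0/=; apply: le_trans dsh; rewrite lerDl sumr_ge0.
move: us hM dsh; rewrite {s}sE => us hM dsh.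
move: us; rewrite cat_uniq => /and3P[_ /hasPn s12 us2].
move: uds => /= /andP[uds udss].
have [||g [gds gh]] := IH s2 us2 udss.
- by move=> x xs; apply: hM; rewrite mem_cat xs orbT.
- by move: dsh; rewrite big_cat/=; lra.
exists (fun x => if x \in s1 then Some u else g x); split.
  move=> x v; case: ifP => [_ [<-]|_ /gds]; first exact: mem_head.
  by rewrite inE => ->; rewrite orbT.
move=> v; rewrite inE => /predU1P[->|vds]; rewrite big_cat/=.
  rewrite big_seq_cond (eq_bigl (fun x => x \in s1)) -?big_seq; last first.
    by move=> x; case: (x \in s1); rewrite ?eqxx.
  by apply: (le_trans ds1); rewrite lerDl sumr_ge0.
apply: (le_trans (gh v vds)); rewrite ler_wpDl ?sumr_ge0//.
rewrite [leLHS]big_seq_cond [leRHS]big_seq_cond le_eqVlt; apply/orP; left; apply/eqP.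
apply: eq_bigl => x; case: (boolP (x \in s2)) => //= xs2.
by have /negPf /= -> := s12 x xs2.
Qed.

(** * Assigning the nodes of a weighted tree to the points of a second tree *)

Section Assignment.
Variables (E : eqType) (good : seq E -> seq E) (h : seq E -> R).
Hypotheses (good_uniq : forall v, uniq (good v)) (h_ge0 : forall v, 0 <= h v)
  (h_good : forall v, h v <= \sum_(e <- good v) h (e :: v)).

(* Words are stored reversed: the parent of a node is its tail. *)
Fixpoint pool (i : nat) : seq (seq E) :=
  if i is i'.+1 then [seq e :: v | v <- pool i', e <- good v] else [:: [::]].

Lemma poolS i v e : (e :: v \in pool i.+1) = (v \in pool i) && (e \in good v).
Proof.
apply/allpairsPdep/andP => [[v' [e' [? ? [-> ->]]]]//|[? ?]].
by exists v, e.
Qed.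

Lemma pool_uniq i : uniq (pool i).
Proof.
elim: i => //= i IH; apply: allpairs_uniq_dep => //.
by move=> [v e] [v' e'] _ _ /= [-> ->].
Qed.

Lemma size_pool i v : v \in pool i -> size v = i.
Proof.
elim: i v => [|i IH] v; first by rewrite inE => /eqP ->.
by move=> /allpairsPdep[v' [e' [/IH <- _ ->]]].
Qed.

Lemma pool_mass i : h [::] <= \sum_(v <- pool i) h v.
Proof.
elim: i => [|i IH]; first by rewrite big_seq1.
by apply: (le_trans IH); rewrite /= big_allpairs_dep; apply: ler_sum.
Qed.

(** Level by level, each [u] owns nodes of total weight at least [w j u - M j], and the children of
    these nodes are shared out greedily among the children of [u]. The shift [a] lets single nodes
    be light compared with the root. *)
Lemma tree_assignment (N : nat -> nat) (p : nat -> nat -> nat) (M : nat -> R)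
    (K q : R) (a : nat) :
  (forall j u, (u < N j.+1)%N -> (p j u < N j)%N) ->
  (forall j, 0 < M j) -> 0 <= K -> 0 <= q <= 2^-1 ->
  (forall j, (N j)%:R * M j <= K * q ^+ j) ->
  (forall j v, v \in pool (a + j) -> h v <= M j) ->
  4 * K <= h [::] ->
  exists phi : nat -> seq E -> option nat,
    [/\ forall j v u, phi j v = Some u -> (u < N j)%N,
        forall j e v u, phi j.+1 (e :: v) = Some u -> phi j v = Some (p j u) &
        forall j u, (u < N j)%N ->
          exists v, [/\ v \in pool (a + j), phi j v = Some u & 0 < h v]].
Proof.
move=> pN M0 K0 q01 NM hM Kh.
have [w [w0 wS wK]] := tree_weights pN (fun j => ltW (M0 j)) K0 q01 NM.
pose Inv j (f : seq E -> option nat) :=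
  (forall v u, f v = Some u -> (u < N j)%N) /\
  forall u, (u < N j)%N ->
    w j u - M j <= \sum_(v <- pool (a + j) | f v == Some u) h v.
have [f0 Inv0] : exists f0, Inv 0%N f0.
  have [||||||g [gN gw]] := @greedy_assignment _ h (M 0%N) (pool (a + 0))
    (index_iota 0 (N 0%N)) (w 0%N) (ltW (M0 _)).
  - exact: pool_uniq.
  - exact: iota_uniq.
  - exact: h_ge0.
  - exact: hM.
  - exact: w0.
  - by apply: (le_trans wK); apply: (le_trans Kh); exact: pool_mass.
  exists g; split=> [v u /gN|u uN]; first by rewrite mem_index_iota.
  by apply: gw; rewrite mem_index_iota.
(* The invariant is a premise below the existential, so that [choice] yields a total step function
   to iterate. *)
have step j f : exists f', Inv j f -> Inv j.+1 f' /\
    forall e v u, f' (e :: v) = Some u -> f v = Some (p j u).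
  have [[fN fw]|?] := pselect (Inv j f); last by exists f.
  (* Supply and demands at [u]: the children of the nodes owned by [u], and the children of [u]. *)
  pose items u := [seq x <- pool (a + j).+1 | f (behead x) == Some u].
  pose ds u := [seq v <- index_iota 0 (N j.+1) | p j v == u].
  have /choice[g gP] : forall u, exists g : seq E -> option nat, (u < N j)%N ->
     (forall x v, g x = Some v -> v \in ds u) /\
     forall v, v \in ds u -> w j.+1 v - M j.+1 <=
        \sum_(x <- items u | g x == Some v) h x.
    move=> u; have [uN|?] := boolP (u < N j)%N; last by exists (fun=> None).
    have [||||||g gh] := @greedy_assignment _ h (M j.+1) (items u)
      (ds u) (w j.+1) (ltW (M0 _)); last by exists g.
    - exact/filter_uniq/pool_uniq.
    - exact/filter_uniq/iota_uniq.
    - exact: h_ge0.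
    - by move=> x; rewrite mem_filter -addnS => /andP[_]; exact: hM.
    - exact: w0.
    have wSu := wS j u uN; have fwu := fw u uN; have M0j := M0 j.
    rewrite !big_filter [leRHS]big_mkcond /= big_allpairs_dep /=.
    (* The owned weight exceeds the demands by at least [M j], and [h_good] passes it on to the
       children. *)
    apply: (@le_trans _ _ (\sum_(v <- pool (a + j) | f v == Some u) h v)); first lra.
    rewrite big_mkcond; apply: ler_sum => v _; case: ifP => // _.
    by rewrite big1.
  exists (fun x => if x is e :: v then
                     if f v is Some u then g u x else None else None).
  move=> _; split; last first.
    move=> e v u; case fvE: (f v) => [u'|//] guv.
    have [gds _] := gP u' (fN _ _ fvE).
    by have := gds _ _ guv; rewrite mem_filter => /andP[/eqP ->].
  split=> [[//|e v] u|u uN].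
    case fvE: (f v) => [u'|//] guv.
    have [gds _] := gP u' (fN _ _ fvE).
    by have := gds _ _ guv; rewrite mem_filter mem_index_iota => /andP[_].
  have [_ /(_ u)] := gP (p j u) (pN _ _ uN).
  rewrite mem_filter eqxx mem_index_iota uN => /(_ isT) /le_trans; apply.
  rewrite big_filter_cond addnS big_seq_cond [leRHS]big_seq_cond.
  rewrite big_mkcond [leRHS]big_mkcond; apply: ler_sum => -[|e v] _.
    by have /negPf -> : [::] \notin pool (a + j).+1 by apply/negP => /size_pool.
  case: ifP => [/and3P[-> /eqP /= -> ->]//|_].
  by case: ifP.
have /choice[F FP] : forall jf : nat * (seq E -> option nat), exists f',
   Inv jf.1 jf.2 -> Inv jf.1.+1 f' /\
    forall e v u, f' (e :: v) = Some u -> jf.2 v = Some (p jf.1 u).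
  by move=> [j f]; exact: step.
pose phi := fix phi j := if j is j'.+1 then F (j', phi j') else f0.
have phiInv j : Inv j (phi j) by elim: j => // j IH; apply: (FP (j, phi j) IH).1.
exists phi; split.
- by move=> j; exact: (phiInv j).1.
- by move=> j; exact: (FP (j, phi j) (phiInv j)).2.
move=> j u uN; have := (phiInv j).2 u uN; have := wS j u uN; have := M0 j.
have : 0 <= \sum_(0 <= v < N j.+1 | p j v == u) w j.+1 v by exact: sumr_ge0.
move=> s0 Mj wj wh.
(* Here [w j u - M j] is still at least [M j > 0], so some owned node has positive weight. *)
have : 0 < \sum_(v <- pool (a + j) | phi j v == Some u) h v by lra.
apply: contraPP => nov; apply/negP; rewrite -leNgt big_seq_cond sumr_le0//.
move=> v /andP[vp /eqP phiv]; rewrite leNgt; apply/negP => hv.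
by apply: nov; exists v.
Qed.

End Assignment.
End TreeAssignment.

(** * Cubes *)

Section Cubes.
Variables (R : realType) (n b : nat) (c0 : 'rV[R]_n) (a : R).
Hypotheses (b_gt0 : (0 < b)%N) (a_gt0 : 0 < a).
Local Notation E := {ffun 'I_n -> 'I_b}.

Fixpoint corner (v : seq E) : 'rV[R]_n :=
  if v is e :: v' then
    \row_i (corner v' 0 i + a / b%:R ^+ size v * (e i)%:R)
  else c0.

(** The cubes are closed, so they cut compact pieces out of a compact set; neighbours share faces,
    hence the parity selection below. *)
Definition cube (v : seq E) : set 'rV[R]_n :=
  [set x | forall i, corner v 0 i <= x 0 i <= corner v 0 i + a / b%:R ^+ size v].

Lemma cube_sideS (k : nat) : a / b%:R ^+ k.+1 * b%:R = a / b%:R ^+ k.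
Proof. by rewrite exprSr invfM mulrA mulfVK// pnatr_eq0 -lt0n. Qed.

Lemma cube_side_ge0 (k : nat) : 0 <= a / b%:R ^+ k.
Proof. by rewrite divr_ge0 ?(ltW a_gt0)// exprn_ge0. Qed.

Lemma cube_child e v : cube (e :: v) `<=` cube v.
Proof.
move=> x xe i; have /andP[] := xe i; rewrite mxE => x1 x2.
have ei : (e i)%:R + 1 <= b%:R :> R by rewrite natr1 ler_nat.
have side := cube_side_ge0 (size v).+1.
have := ler_wpM2l side ei; rewrite cube_sideS mulrDr mulr1 => h.
have h2 : 0 <= a / b%:R ^+ (size v).+1 * (e i)%:R by rewrite mulr_ge0.
by apply/andP; split; move: x1 x2 h h2 => /=; lra.
Qed.

Lemma cube_cover v x : cube v x -> exists e, cube (e :: v) x.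
Proof.
move=> xv; have side : 0 < a / b%:R ^+ (size v).+1.
  by rewrite divr_gt0 ?exprn_gt0 ?ltr0n.
set l := a / b%:R ^+ (size v).+1 in side *.
pose t i := (x 0 i - corner v 0 i) / l.
have t0 i : 0 <= t i.
  by rewrite divr_ge0 ?(ltW side)// subr_ge0; case/andP: (xv i).
(* The minimum handles the far face [t i = b], where truncation alone would give the digit [b]. *)
pose e i := minn (Num.truncn (t i)) b.-1.
have eb i : (e i < b)%N.
  by rewrite (leq_ltn_trans (geq_minr _ _))// prednK.
exists [ffun i => Ordinal (eb i)] => i; rewrite mxE ffunE /= -/l.
have xE : x 0 i = corner v 0 i + l * t i.
  by rewrite mulrC divfK ?gt_eqF// subrKC.
rewrite xE lerD2l -addrA lerD2l -[X in _ + X]mulr1 -mulrDr !ler_pM2l//.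
have tb : t i <= b%:R.
  rewrite ler_pdivrMr// mulrC /l cube_sideS lerBlDl; by case/andP: (xv i).
have /andP[tr1 tr2] := truncn_itv (t0 i).
rewrite natr1 /e; apply/andP; split.
  by apply: le_trans tr1; rewrite ler_nat geq_minl.
have [h|h] := leqP (Num.truncn (t i)) b.-1.
  by rewrite ltW.
by rewrite prednK.
Qed.

Lemma cube_dist v x y : cube v x -> cube v y ->
  `|x - y| <= a / b%:R ^+ size v.
Proof.
move=> xv yv; apply: norm_le_coord => [|i]; first exact: cube_side_ge0.
rewrite !mxE ler_norml; have := xv i; have := yv i.
by move=> /andP[? ?] /andP[? ?]; apply/andP; split; lra.
Qed.

Lemma cube_closed v : closed (cube v).
Proof.
have -> : cube v = \bigcap_i ((fun x : 'rV[R]_n => x 0 i) @^-1`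
    [set y | corner v 0 i <= y <= corner v 0 i + a / b%:R ^+ size v]).
  by apply/seteqP; split=> [x xv i _|x xv i]; [exact: xv | exact: (xv i)].
apply: closed_bigI => i _; apply: (continuous_closedP _).1.
  by move=> x; exact: coord_continuous.
have := @itv_closed _ R (corner v 0 i) (corner v 0 i + a / b%:R ^+ size v).
by rewrite set_itvcc.
Qed.

Definition parity (e : E) : {ffun 'I_n -> bool} := [ffun i => odd (e i)].

(** Distinct digits of equal parity differ by at least 2 in some coordinate, which leaves a full
    side between the two cubes. *)
Lemma cube_separated e e' v x y : parity e = parity e' -> e != e' ->
  cube (e :: v) x -> cube (e' :: v) y -> a / b%:R ^+ (size v).+1 <= `|x - y|.
Proof.
have main (f f' : E) (z z' : 'rV[R]_n) i : (f i < f' i)%N ->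
    odd (f i) = odd (f' i) -> cube (f :: v) z -> cube (f' :: v) z' ->
    a / b%:R ^+ (size v).+1 <= `|z - z'|.
  move=> ff' oddE zf zf'; apply: le_trans (norm_coord_le (z - z') i).
  rewrite !mxE distrC; apply: le_trans (ler_norm _).
  have /andP[_] := zf i; have /andP[+ _] := zf' i; rewrite !mxE /=.
  have f2 : (f i)%:R + 2 <= (f' i)%:R :> R.
    rewrite -natrD ler_nat addn2 ltn_neqAle ff' andbT.
    by apply/eqP => h; move: oddE; rewrite -h /=; case: odd.
  have := ler_wpM2l (cube_side_ge0 (size v).+1) f2; rewrite mulrDr.
  lra.
move=> pE ee' xe ye'; have /forallPn[i ei] : ~~ [forall i, e i == e' i].
  by apply: contra ee' => /forallP h; apply/eqP/ffunP => i; exact: (eqP (h i)).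
have oddE : odd (e i) = odd (e' i) by move/ffunP/(_ i): pE; rewrite !ffunE.
have := ei; rewrite -val_eqE neq_ltn => /orP[h|h]; first exact: main h oddE xe ye'.
by rewrite distrC; exact: main h (esym oddE) ye' xe.
Qed.

(** There are [2 ^+ n] parity classes, and one of them carries at least the average. *)
Lemma parity_pigeonhole (F : E -> R) :
  exists c, \sum_e F e <= 2 ^+ n * \sum_(e | parity e == c) F e.
Proof.
apply: contrapT => noc.
have FE : \sum_e F e = \sum_(c : {ffun 'I_n -> bool}) \sum_(e | parity e == c) F e.
  by rewrite (partition_big parity xpredT).
have : \sum_(c : {ffun 'I_n -> bool}) 2 ^+ n * \sum_(e | parity e == c) F e <
       \sum_(c : {ffun 'I_n -> bool}) \sum_e F e.
  apply: ltr_sum.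
    by apply/hasP; exists [ffun=> true]; rewrite ?mem_index_enum.
  by move=> c _; rewrite ltNge; apply/negP => h; apply: noc; exists c.
rewrite -mulr_sumr -FE sumr_const card_ffun card_bool card_ord.
by rewrite -[ltRHS]mulr_natl natrX ltxx.
Qed.

End Cubes.

(** * Lipschitz images *)

Section LipschitzOnto.
Variables (R : realType) (n : nat).
Implicit Types (A B : set 'rV[R]_n).

(* The balls are taken for the maximum norm; this only changes [C]. *)
Definition box_bounded B (t : R) : Prop :=
  exists C rho0 : R, [/\ 0 < C, 0 < rho0 & forall rho, 0 < rho <= rho0 ->
    exists (k : nat) (c : nat -> 'rV[R]_n),
      [/\ forall u, (u < k)%N -> B (c u),
          forall y, B y -> exists2 u, (u < k)%N & `|c u - y| <= rho &
          k%:R <= C * rho `^ (- t)]].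

Lemma pairr_continuous (T U : topologicalType) (y : U) :
  continuous (fun x : T => (x, y)).
Proof.
move=> x; apply: (@cvg_pair _ _ _ _ (nbhs x) (nbhs y)); first exact: cvg_id.
exact: cvg_cst.
Qed.

(** Cantor's intersection theorem: a cluster point of a sequence chosen in the successive sets lies
    in all of them. *)
Lemma nested_compact (T : topologicalType) (K : set T) (X : nat -> set T) :
  compact K -> (forall j, closed (X j)) -> (forall j, X j.+1 `<=` X j) ->
  (forall j, (K `&` X j) !=set0) -> exists2 x, K x & forall j, X j x.
Proof.
move=> Kc Xc XS Xn0.
have Xle i j : (i <= j)%N -> X j `<=` X i.
  elim: j => [|j IH]; first by rewrite leqn0 => /eqP ->.
  rewrite leq_eqVlt => /predU1P[-> //|]; rewrite ltnS => /IH.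
  exact: subset_trans (XS j).
have /choice[x xP] := Xn0.
have [p [Kp clp]] : K `&` cluster (x @ \oo) !=set0.
  by apply: Kc; exists 0%N => // j _; have [] := xP j.
exists p => // j; apply: Xc => U Up.
have : (x @ \oo) (X j).
  by exists j => // i /= ji; have [_ /(Xle _ _ ji)] := xP i.
by move=> /clp/(_ Up)[z [? ?]]; exists z.
Qed.

(** Only the best parity class among the children of a cube is kept. The factor [2 ^+ (n * size v)]
    in [h] makes up for this loss, and comparing content with the gauge of a single cube gives the
    last bound. *)
Lemma content_tree A (s d : R) (b : nat) (c0 : 'rV[R]_n) (a : R) :
  (0 < b)%N -> 0 < a -> 0 <= s -> n%:R * a <= d ->
  (0 < hausdorff_premeasure s d (A `&` cube c0 a (Nil {ffun 'I_n -> 'I_b})))%E ->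
  exists (good : seq {ffun 'I_n -> 'I_b} -> seq {ffun 'I_n -> 'I_b})
         (h : seq {ffun 'I_n -> 'I_b} -> R),
    [/\ forall v, uniq (good v),
        forall v e e', e \in good v -> e' \in good v -> parity e = parity e',
        forall v, 0 <= h v,
        forall v, h v <= \sum_(e <- good v) h (e :: v) & 0 < h [::]] /\
    (forall v, 0 < h v -> (A `&` cube c0 a v) !=set0) /\
    (forall v, h v <= (n%:R * a) `^ s * (2 ^+ n / b%:R `^ s) ^+ size v).
Proof.
move=> b0 a0 s0 nad H0.
have b0R : 0 < b%:R :> R by rewrite ltr0n.
pose H (v : seq {ffun 'I_n -> 'I_b}) := hausdorff_premeasure s d (A `&` cube c0 a v).
have H_ge0 v : (0 <= H v)%E by exact: hausdorff_premeasure_ge0.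
have side_le k : a / b%:R ^+ k <= a.
  by rewrite ler_pdivrMr ?exprn_gt0// ler_peMr ?(ltW a0)// exprn_ege1// ler1n.
have H_le v : (H v <= ((n%:R * (a / b%:R ^+ size v)) `^ s)%:E)%E.
  apply: hausdorff_premeasure_le => //; first exact: cube_side_ge0.
    by apply: le_trans nad; rewrite ler_wpM2l.
  by move=> x y [_ xv] [_ yv]; exact: cube_dist xv yv.
have Hfin v : H v \is a fin_num.
  by rewrite ge0_fin_numE// (le_lt_trans (H_le v)) ?ltry.
pose h (v : seq {ffun 'I_n -> 'I_b}) := 2 ^+ (n * size v) * fine (H v).
have pow_gt0 k : 0 < 2 ^+ k :> R by rewrite exprn_gt0.
have Hsub v : fine (H v) <= \sum_e fine (H (e :: v)).
  rewrite -lee_fin fineK// -sumEFin.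
  under eq_bigr do rewrite fineK//.
  apply: hausdorff_premeasure_bigcup => x [Ax /(cube_cover b0 a0)[e xe]].
  by rewrite -bigcup_seq; exists e => //=; exact: mem_index_enum.
have /choice[best bestP] v := @parity_pigeonhole R n b (fun e => fine (H (e :: v))).
pose good v := [seq e <- index_enum {ffun 'I_n -> 'I_b} | parity e == best v].
exists good, h; split; [split|split].
- by move=> v; rewrite filter_uniq ?index_enum_uniq.
- by move=> v e e'; rewrite !mem_filter => /andP[/eqP -> _] /andP[/eqP -> _].
- by move=> v; rewrite mulr_ge0 ?fine_ge0// ltW.
- move=> v; rewrite big_filter /h /= -mulr_sumr mulnS exprD -mulrA.
  rewrite [leRHS]mulrCA ler_pM2l//.
  exact: le_trans (Hsub v) (bestP v).
- by rewrite /h muln0 expr0 mul1r fine_gt0// H0/= ltey_eq Hfin.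
- move=> v; rewrite /h pmulr_rgt0// => Hv; apply/set0P/eqP => Av0.
  by move: Hv; rewrite /H Av0 hausdorff_premeasure0 ltxx.
- move=> v; have := H_le v; rewrite -(fineK (Hfin v)) lee_fin => Hv.
  rewrite /h exprMn -exprM mulrCA ler_pM2l//; apply: (le_trans Hv).
  rewrite mulrA powRM ?mulr_ge0 ?(ltW a0) ?invr_ge0 ?exprn_ge0//.
  rewrite ler_wpM2l ?powR_ge0// -powR_inv1 ?exprn_ge0//.
  rewrite -powR_mulrn// -!powRrM -powR_inv1 ?powR_ge0// -powRrM.
  rewrite -powR_mulrn ?powR_ge0// -powRrM.
  by rewrite le_eqVlt; apply/orP; left; apply/eqP; congr (_ `^ _); ring.
Qed.

(** Finitely many cubes of side [a] cover [A], and content is subadditive, so one of them has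
    positive content. *)
Lemma local_content A (s d a : R) (b : nat) : compact A -> 0 < a ->
  (0 < hausdorff_premeasure s d A)%E ->
  exists c0, (0 < hausdorff_premeasure s d
    (A `&` cube c0 a (Nil {ffun 'I_n -> 'I_b})))%E.
Proof.
move=> + a0 HA; rewrite compact_cover => Ac; apply: contrapT => noc.
have a20 : 0 < a / 2 by rewrite divr_gt0.
have [|x Ax|D DA AD] := Ac _ A (fun x => ball x (a / 2)).
- by move=> x Ax; exact: ball_open.
- by exists x => //; exact: ballxx.
suff : (hausdorff_premeasure s d A <= 0)%E by rewrite leNgt HA.
pose c x := x - const_mx (a / 2) : 'rV[R]_n.
apply: le_trans (@hausdorff_premeasure_bigcup _ _ s d _ (finmap.enum_fset D)
  (fun x => A `&` cube (c x) a (Nil {ffun 'I_n -> 'I_b})) A _) _; last first.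
  apply: sume_le0 => x _; rewrite leNgt; apply/negP => h.
  by apply: noc; exists (c x).
move=> y Ay; have [x xD xy] := AD y Ay; rewrite -bigcup_seq; exists x => //=.
split=> // i; rewrite /= expr0 divr1 !mxE.
have : `|(x - y) 0 i| < a / 2.
  apply: le_lt_trans (norm_coord_le _ _) _.
  by move: xy; rewrite /= -ball_normE.
rewrite !mxE ltr_norml => /andP[h1 h2]; apply/andP; split; lra.
Qed.

(** It suffices that the power [s - t] of [b] be at least [2 ^+ n.+1]; [x] is this threshold. *)
Lemma branching_base (s t : R) : 0 < t < s ->
  exists2 b : nat, (1 < b)%N &
    2 ^+ n / b%:R `^ s * b%:R `^ t <= 2^-1 :> R.
Proof.
move=> /andP[t0 ts]; have st : 0 < s - t by rewrite subr_gt0.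
pose x : R := (2 ^+ n.+1) `^ (s - t)^-1.
exists (Num.truncn x).+2 => //; set b := (_.+2)%:R : R.
have b0 : 0 < b by rewrite ltr0n.
have xb : x <= b.
  by rewrite ltW// (lt_trans (truncnS_gt x))// ltr_nat.
have : x `^ (s - t) <= b `^ (s - t).
  by apply: ge0_ler_powR => //; rewrite ?nnegrE ?powR_ge0 ?ltW.
rewrite -powRrM mulVf ?gt_eqF// powRr1 ?exprn_ge0// => h.
have bst : b `^ s = b `^ (s - t) * b `^ t.
  by rewrite -powRD ?subrK//; apply/implyP => _; rewrite gt_eqF.
rewrite bst invfM mulrA mulfVK ?gt_eqF ?powR_gt0//.
rewrite ler_pdivrMr ?powR_gt0// -ler_pdivrMl ?invr_gt0// invrK.
by rewrite -exprS.
Qed.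

(** The map is built through its graph [G]: the pairs of [A] and [B] whose cubes and net points
    match at every level. Compactness of [G] gives a compact domain, and the Lipschitz estimate
    makes [G] single-valued. *)
Lemma lipschitz_onto A B (s t d : R) : (0 < n)%N -> compact A -> compact B ->
  0 < t < s -> 0 < d -> (0 < hausdorff_premeasure s d A)%E -> box_bounded B t ->
  exists (A' : set 'rV[R]_n) (f : 'rV[R]_n -> 'rV[R]_n),
    [/\ compact A', A' `<=` A, f @` A' = B &
      exists L, forall x y, A' x -> A' y -> `|f x - f y| <= L * `|x - y|].
Proof.
move=> n0 Acpt Bcpt ts d0 HA [C [rho0 [C0 rho00 Bbox]]].
have nR : 0 < n%:R :> R by rewrite ltr0n.
have [t0 s0] : 0 < t /\ 0 < s by case/andP: ts => t0 /(lt_trans t0).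
have [b b1 qle] := branching_base ts.
have b0 : (0 < b)%N by exact: ltnW.
have bR : 0 < b%:R :> R by rewrite ltr0n.
have b2 : 2 <= b%:R :> R by rewrite ler_nat.
pose a := d / n%:R.
have a0 : 0 < a by rewrite divr_gt0.
have [c0 Hc0] := local_content b Acpt a0 HA.
have nad : n%:R * a <= d by rewrite /a mulrC divfK ?gt_eqF.
have [good [h [[guniq gpar h0 hgood hroot] [hA hle]]]] :=
  content_tree b0 a0 (ltW s0) nad Hc0.
set beta := 2 ^+ n / b%:R `^ s in qle hle.
have beta0 : 0 < beta by rewrite divr_gt0 ?exprn_gt0 ?powR_gt0.
set q := beta * b%:R `^ t in qle.
have q0 : 0 <= q by rewrite mulr_ge0 ?powR_ge0 ?ltW.
have beta_half : beta <= 2^-1.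
  apply: le_trans qle; rewrite ler_peMr ?(ltW beta0)//.
  by rewrite -[leLHS](powRr0 b%:R) ler_powR ?(ltW t0)// ler1n.
pose rho (j : nat) := rho0 / b%:R ^+ j.
have rho_gt0 j : 0 < rho j by rewrite divr_gt0 ?exprn_gt0.
have rhoS j : 2 * rho j.+1 <= rho j.
  by rewrite {2}/rho -(cube_sideS _ b0) -/(rho _) mulrC ler_wpM2l// ltW.
have rho_le j : rho j <= rho0.
  by rewrite ler_pdivrMr ?exprn_gt0// ler_peMr ?(ltW rho00)// exprn_ege1// ler1n.
have /choice[Nc NcP] : forall j : nat, exists kc : nat * (nat -> 'rV[R]_n),
    [/\ forall u, (u < kc.1)%N -> B (kc.2 u),
        forall y, B y -> exists2 u, (u < kc.1)%N & `|kc.2 u - y| <= rho j &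
        kc.1%:R <= C * rho j `^ (- t)].
  by move=> j; have [|k [c kc]] := Bbox (rho j); rewrite ?rho_gt0 ?rho_le//; exists (k, c).
pose N j := (Nc j).1; pose c j := (Nc j).2.
have /choice[p pP] : forall j, exists p : nat -> nat, forall u, (u < N j.+1)%N ->
    (p u < N j)%N /\ `|c j (p u) - c j.+1 u| <= rho j.
  move=> j; suff /choice[p pP] : forall u, exists v, (u < N j.+1)%N ->
      (v < N j)%N /\ `|c j v - c j.+1 u| <= rho j by exists p.
  move=> u; have [uN|?] := boolP (u < N j.+1)%N; last by exists 0%N.
  have [/(_ u uN) Bu _ _] := NcP j.+1; have [_ /(_ _ Bu)[v vN vu] _] := NcP j.
  by exists v.
pose K0 := C * rho0 `^ (- t) * (n%:R * a) `^ s.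
have na0 : 0 < n%:R * a by exact: mulr_gt0.
have K00 : 0 < K0 by do !apply: mulr_gt0 => //; exact: powR_gt0.
(* Level [j] of the nets is matched with level [m + j] of the cubes; [m] is so deep that the root
   can pay for the whole tree of net points. *)
have [m hm] : exists m : nat, 4 * (K0 * beta ^+ m) <= h [::].
  have K40 : 0 < 4 * K0 by rewrite pmulr_rgt0.
  have e0 : 0 < h [::] / (4 * K0) by exact: divr_gt0.
  have : beta ^+ m @[m --> \oo] --> 0.
    by apply: cvg_expr; rewrite gtr0_norm// (le_lt_trans beta_half)// invf_lt1 ?ltr1n.
  move=> /cvgrPdist_le/(_ _ e0)[m _ /(_ m (leqnn m))] /=.
  rewrite sub0r normrN ger0_norm ?exprn_ge0 ?(ltW beta0)//.
  by rewrite ler_pdivlMr// => hm; exists m; rewrite mulrA mulrC.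
pose M j := (n%:R * a) `^ s * beta ^+ (m + j).
have M0 j : 0 < M j by rewrite mulr_gt0 ?powR_gt0 ?exprn_gt0.
have NM j : (N j)%:R * M j <= K0 * beta ^+ m * q ^+ j.
  have [_ _ Nj] := NcP j.
  apply: le_trans (ler_wpM2r (ltW (M0 j)) Nj) _.
  have -> : rho j `^ (- t) = rho0 `^ (- t) * (b%:R `^ t) ^+ j.
    rewrite /rho powRM ?invr_ge0 ?exprn_ge0 ?(ltW rho00)//; congr (_ * _).
    rewrite -powR_inv1 ?exprn_ge0// -powRrM mulN1r opprK.
    by rewrite -powR_mulrn// -powRrM mulrC powRrM powR_mulrn// powR_ge0.
  rewrite /M /K0 /q exprD [(beta * _) ^+ j]exprMn le_eqVlt; apply/orP; left; apply/eqP; ring.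
have hM j v : v \in pool good (m + j) -> h v <= M j.
  by move=> vp; rewrite /M -(size_pool vp).
have K1 : 0 <= K0 * beta ^+ m by rewrite ltW// mulr_gt0// exprn_gt0.
have q01 : 0 <= q <= 2^-1 by rewrite q0.
have [phi [phiN phiS phiex]] := tree_assignment guniq h0 hgood
  (fun j u uN => (pP j u uN).1) M0 K1 q01 NM hM hm.
have poolP j v : v \in pool good (m + j.+1) -> exists e w,
    [/\ v = e :: w, w \in pool good (m + j) & e \in good w].
  rewrite addnS; case: v => [/size_pool//|e w].
  by rewrite poolS => /andP[? ?]; exists e, w.
(* The radius [2 * rho j] makes these sets nested: a parent is within [rho j], and
   [2 * rho j.+1 <= rho j]. *)
pose F j v := [set z : 'rV[R]_n * 'rV[R]_n | exists u,
  [/\ phi j v = Some u, cube c0 a v z.1 & `|c j u - z.2| <= 2 * rho j]].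
have Fparent j e v : F j.+1 (e :: v) `<=` F j v.
  move=> z [u [phiu zv zu]]; exists (p j u); split; first exact: phiS phiu.
    exact: cube_child zv.
  have [_ pu] := pP j u (phiN _ _ _ phiu).
  have -> : c j (p j u) - z.2 = (c j (p j u) - c j.+1 u) + (c j.+1 u - z.2).
    by rewrite addrA subrK.
  apply: le_trans (ler_normD _ _) _; have := rhoS j; lra.
have Fdist j v z z' : F j v z -> F j v z' -> `|z.2 - z'.2| <= 4 * rho j.
  move=> [u [phiu _ zu]] [u' [+ _ zu']]; rewrite phiu => -[uE].
  have -> : z.2 - z'.2 = - (c j u - z.2) + (c j u' - z'.2).
    by rewrite uE opprB addrA subrK.
  apply: le_trans (ler_normD _ _) _; rewrite normrN; lra.
have [Delta Delta0 BDelta] : exists2 Delta, 0 <= Delta &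
    forall y y', B y -> B y' -> `|y - y'| <= Delta.
  have [M1 [_ BM]] := compact_bounded Bcpt.
  exists (2 * (`|M1| + 1)) => [|y y' By By']; first by rewrite mulr_ge0 ?addr_ge0.
  have M1lt : M1 < `|M1| + 1 by rewrite ltr_pwDr// ler_norm.
  have := BM _ M1lt y By; have := BM _ M1lt y' By'.
  move=> /= h1 h2; apply: le_trans (ler_normB _ _) _; lra.
(* The first term serves pairs whose cubes already differ at depth [m], the second those whose cubes
   part later. *)
pose L := Delta * (b%:R ^+ m / a) + 4 * rho0 * (b%:R ^+ m.+1 / a).
have bk0 k : 0 < b%:R ^+ k :> R by rewrite exprn_gt0.
have bka k : 0 <= b%:R ^+ k / a by exact/ltW/divr_gt0.
have akb k : 0 <= a / b%:R ^+ k by exact/ltW/divr_gt0.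
have cancel k : b%:R ^+ k / a * (a / b%:R ^+ k) = 1.
  by rewrite mulrA divfK ?gt_eqF// divff ?gt_eqF.
have L1 : 0 <= Delta * (b%:R ^+ m / a) by exact: mulr_ge0.
have L2 : 0 <= 4 * rho0 * (b%:R ^+ m.+1 / a).
  by apply: mulr_ge0 => //; apply: mulr_ge0 => //; exact: ltW.
have L0 : 0 <= L by exact: addr_ge0.
have poolsep i v v' x x' : v \in pool good i -> v' \in pool good i ->
    v != v' -> cube c0 a v x -> cube c0 a v' x' -> a / b%:R ^+ i <= `|x - x'|.
  elim: i v v' => [|i IH] v v'; first by rewrite !inE => /eqP -> /eqP ->; rewrite eqxx.
  move=> /allpairsPdep[w [e [wp eg ->]]] /allpairsPdep[w' [e' [wp' eg' ->]]].
  have [ww|ww'] := eqVneq w w'; last first.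
    move=> _ /(cube_child b0 a0) xw /(cube_child b0 a0) xw'.
    apply: le_trans (IH _ _ wp wp' ww' xw xw').
    by rewrite -(cube_sideS _ b0 i) ler_peMr ?ler1n// ltW// divr_gt0.
  subst w'; move=> ee' xe xe'; rewrite -(size_pool wp); apply: cube_separated xe xe' => //.
    exact: gpar eg eg'.
  by apply: contra ee' => /eqP ->.
(* Descend to the first level where the cubes differ: the common parent bounds the distance in [B]
   by [4 * rho j], and [poolsep] bounds the distance in [A] from below. *)
have key j v v' z z' : B z.2 -> B z'.2 ->
    v \in pool good (m + j) -> v' \in pool good (m + j) ->
    v != v' -> F j v z -> F j v' z' -> `|z.2 - z'.2| <= L * `|z.1 - z'.1|.
  move=> Bz Bz'; elim: j v v' => [|j IH] v v' vp v'p vv' Fv Fv'.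
    have [[_ [_ zv _]] [_ [_ zv' _]]] := (Fv, Fv').
    have := poolsep _ _ _ _ _ vp v'p vv' zv zv'; rewrite addn0 => sep.
    apply: (@le_trans _ _ (Delta * (b%:R ^+ m / a) * (a / b%:R ^+ m))).
      by rewrite -mulrA cancel mulr1 BDelta.
    by apply: ler_pM => //; rewrite lerDl.
  have [e [w [vE wp eg]]] := poolP _ _ vp.
  have [e' [w' [v'E w'p eg']]] := poolP _ _ v'p.
  move: Fv Fv' vv' vp v'p; rewrite vE v'E => Fv Fv' vv' vp v'p.
  have [ww'|ww'] := eqVneq w w'; last first.
    by apply: IH wp w'p ww' _ _; [exact: Fparent Fv|exact: Fparent Fv'].
  have d4 := Fdist _ _ _ _ (Fparent _ _ _ _ Fv).
  have [[_ [_ zv _]] [_ [_ zv' _]]] := (Fv, Fv').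
  have sep := poolsep _ _ _ _ _ vp v'p vv' zv zv'.
  apply: (le_trans (d4 _ _)); first by rewrite ww'; exact: Fparent Fv'.
  apply: (@le_trans _ _ (4 * rho0 * (b%:R ^+ m.+1 / a) * (a / b%:R ^+ (m + j.+1)))).
    rewrite /rho le_eqVlt; apply/orP; left; apply/eqP.
    rewrite addnS -addSn exprD; field.
    by rewrite !expf_neq0 ?gt_eqF.
  by apply: ler_pM => //; rewrite lerDr.
pose G := [set z | (A `*` B) z /\
  forall j, (\bigcup_(v in [set` pool good (m + j)]) F j v) z].
have rho_cvg : 4 * rho j @[j --> \oo] --> 0.
  rewrite -[0](mulr0 (4 * rho0)).
  have -> : (fun j => 4 * rho j) = (fun j => 4 * rho0 * (b%:R^-1) ^+ j).
    by apply/funext => j; rewrite /rho exprVn mulrA.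
  apply: cvgM; first exact: cvg_cst.
  by apply: cvg_expr; rewrite gtr0_norm ?invr_gt0// invf_lt1// (lt_le_trans _ b2)// ltr1n.
(* If the estimate failed, the cubes would agree at every level by [key], forcing the second
   coordinates to coincide. *)
have Glip z z' : G z -> G z' -> `|z.2 - z'.2| <= L * `|z.1 - z'.1|.
  move=> [[_ Bz] Gz] [[_ Bz'] Gz'].
  rewrite leNgt; apply/negP => lt.
  have near_eq j : `|z.2 - z'.2| <= 4 * rho j.
    have [v /= vp Fv] := Gz j; have [v' /= v'p Fv'] := Gz' j.
    have [vv'|vv'] := eqVneq v v'; first by apply: Fdist Fv _; rewrite vv'.
    by move: lt; rewrite ltNge (key _ _ _ _ _ Bz Bz' vp v'p vv' Fv Fv').
  have : `|z.2 - z'.2| <= 0.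
    rewrite -(cvg_lim _ rho_cvg)//; apply: limr_ge; first exact: cvgP rho_cvg.
    exact: nearW.
  by apply/negP; rewrite -ltNge (le_lt_trans _ lt)// mulr_ge0.
have Fclosed j v : closed (F j v).
  case phiE: (phi j v) => [u|]; last first.
    have -> : F j v = set0; last exact: closed0.
    by rewrite -subset0 => z [u []]; rewrite phiE.
  have -> : F j v = (fst @^-1` cube c0 a v) `&`
      (snd @^-1` closed_ball_ Num.norm (c j u) (2 * rho j)).
    apply/seteqP; split=> [z [u' [+ zv zu]]|z [? ?]]; last by exists u.
    by rewrite phiE => -[uE]; split=> //=; rewrite uE.
  apply: closedI; apply: (continuous_closedP _).1.
  - by move=> x; exact: cvg_fst.
  - exact: cube_closed.
  - by move=> x; exact: cvg_snd.
  - exact: closed_closed_ball_.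
have Gcpt : compact G.
  have -> : G = (A `*` B) `&`
      \bigcap_j \bigcup_(v in [set` pool good (m + j)]) F j v.
    apply/seteqP; split=> [z [zAB Gz]|z [zAB Gz]].
      by split; [exact: zAB | move=> j _; exact: (Gz j)].
    by split; [exact: zAB | move=> j; exact: (Gz j I)].
  apply: compact_closedI; first exact: compact_setX.
  apply: closed_bigI => j _; apply: closed_bigcup => //.
  exact: finite_seq.
have GA z : G z -> A z.1 by case=> -[].
have GB z : G z -> B z.2 by case=> -[].
have Gonto y : B y -> exists x, G (x, y).
  move=> By.
  pose X j := (fun x : 'rV[R]_n => (x, y)) @^-1`
    (\bigcup_(v in [set` pool good (m + j)]) F j v).
  have [||||x Ax Xx] := @nested_compact _ A X.
  - exact: Acpt.
  - move=> j; apply: (continuous_closedP _).1.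
      exact: pairr_continuous.
    by apply: closed_bigcup => //; exact: finite_seq.
  - move=> j x [v /= /poolP[e [w [-> wp _]]] Fv].
    by exists w; [exact: wp | exact: (Fparent j e w (x, y) Fv)].
  (* A net point near [y] owns a cube of positive weight, and such a cube meets [A]. *)
  - move=> j; have [_ /(_ y By)[u uN yu] _] := NcP j.
    have [v [vp phiv /hA[x [Ax xv]]]] := phiex j u uN.
    exists x; split=> //; exists v => //; exists u; split=> //=.
    by apply: (le_trans yu); have := rho_gt0 j; rewrite -/(rho j); lra.
  by exists x.
pose A' := fst @` G.
have /choice[f fP] : forall x, exists y, A' x -> G (x, y).
  move=> x; have [[z Gz <-]|?] := pselect (A' x); last by exists 0.
  by exists z.2; case: z Gz.
exists A', f; split.
- apply: continuous_compact => //; apply: continuous_subspaceT => z.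
  exact: cvg_fst.
- by move=> _ [z Gz <-]; exact: GA.
- apply/seteqP; split=> [_ [x A'x <-]|y By]; first exact: (GB _ (fP _ A'x)).
  have [x Gxy] := Gonto y By.
  have A'x : A' x by exists (x, y).
  exists x => //; apply/eqP; rewrite -subr_eq0 -normr_le0.
  by have := Glip _ _ (fP x A'x) Gxy; rewrite /= subrr normr0 mulr0.
- by exists L => x y A'x A'y; exact: (Glip (x, f x) (y, f y) (fP _ A'x) (fP _ A'y)).
Qed.

End LipschitzOnto.

(** * Box dimension *)

Section BoxDimension.
Variables (R : realType) (n : nat).
Implicit Types (X : set 'rV[R]_n).

Lemma covering_number_ge1 X (r : R) : X !=set0 -> (1 <= covering_number X r)%E.
Proof.
move=> [x Xx]; apply: le_ereal_inf_tmp => _ [k [c [_ cX]] <-].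
by case: k c cX => [c /(_ x Xx)[[]]//|k _ _]; rewrite lee_fin ler1n.
Qed.

Lemma upper_box_dim_ge0 X : (0 <= upper_box_dim X)%E.
Proof.
rewrite /upper_box_dim; case: ifPn => // /set0P X0.
apply: le_ereal_inf_tmp => _ [V V0 <-].
(* A radius below [1] makes the logarithm in the denominator positive. *)
have [r [/andP[r0 r1] Vr]] : exists r : R, 0 < r < 1 /\ V r.
  move: V0 => [e /= e0 eV]; pose r := Num.min (e / 2) 2^-1.
  have r0 : 0 < r by rewrite lt_min divr_gt0//= invr_gt0.
  have re : r <= e / 2 by rewrite ge_min lexx.
  have rhalf : r <= 2^-1 by rewrite ge_min lexx orbT.
  exists r; split; first by rewrite r0 (le_lt_trans rhalf)// invf_lt1 ?ltr1n.
  apply: eV => //=; rewrite sub0r normrN gtr0_norm//.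
  by rewrite (le_lt_trans re)// ltr_pdivrMr// ltr_pMr// ltr1n.
apply: (@le_trans _ _
  (lne (covering_number X r) * ((ln r^-1)^-1)%:E)%E); last first.
  by apply: ereal_sup_ubound; exists r.
rewrite mule_ge0// ?lne_ge0 ?covering_number_ge1//.
by rewrite lee_fin invr_ge0 ln_ge0// invf_ge1// ltW.
Qed.

Lemma upper_box_dim_lt X (t : R) :
  X !=set0 -> (upper_box_dim X < t%:E)%E -> box_bounded X t.
Proof.
move=> /[dup] X0 /set0P/negPf Xn0; rewrite /upper_box_dim Xn0.
move=> /ereal_inf_lt[_ [V [e /= e0 eV] <-] Vt].
pose rho0 := Num.min (e / 2) 2^-1.
exists 1, rho0; split=> //; first by rewrite lt_min divr_gt0//= invr_gt0.
move=> rho /andP[rho_gt0]; rewrite le_min => /andP[rho1 rho2].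
have rho_lt1 : rho < 1 by rewrite (le_lt_trans rho2)// invf_lt1 ?ltr1n.
have Vrho : V rho.
  apply: eV => //=; rewrite sub0r normrN gtr0_norm//.
  by rewrite (le_lt_trans rho1)// ltr_pdivrMr// ltr_pMr// ltr1n.
have frho : (lne (covering_number X rho) * ((ln rho^-1)^-1)%:E < t%:E)%E.
  by apply: le_lt_trans Vt; apply: ereal_sup_ubound; exists rho.
have lnpos : 0 < ln rho^-1 by rewrite ln_gt0// invf_gt1.
move: frho; rewrite lte_pdivrMr// -EFinM => frho.
have rhot : 0 < rho `^ (- t) by rewrite powR_gt0.
have : (covering_number X rho < (rho `^ (- t))%:E)%E.
  rewrite ltNge; apply/negP => le.
  move: frho; rewrite ltNge => /negP; apply.
  have -> : (t * ln rho^-1)%:E = lne (rho `^ (- t))%:E :> \bar R.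
    by rewrite lne_EFin// ln_powR lnV// mulrN mulNr.
  have cn0 : (0 <= covering_number X rho)%E.
    by rewrite (le_trans _ (covering_number_ge1 rho X0)).
  by rewrite lee_lne// in_itv/= leey andbT// lee_fin ltW.
move=> /ereal_inf_lt[_ [k [c [cX Xc]] <-]]; rewrite lte_fin => kt.
exists k, (fun u => if insub u is Some i then c i else 0); split.
- by move=> u uk; rewrite insubT; exact: cX.
- move=> y /Xc[i _ yi]; exists i => //.
  by rewrite valK; apply: le_trans (norm_le_eucl _ _) yi.
- by rewrite mul1r ltW.
Qed.

(** A finite union of closed balls is closed, so the balls covering [X] also cover its closure. *)
Lemma box_bounded_closure X (t : R) : box_bounded X t -> box_bounded (closure X) t.
Proof.
move=> [C [rho0 [C0 rho00 Xt]]]; exists C, rho0; split=> // rho /Xt[k [c [cX Xc kC]]].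
exists k, c; split=> // [u /cX|y Xy]; first exact: subset_closure.
have clF : closed (\bigcup_(u in `I_k) closed_ball_ Num.norm (c u) rho).
  by apply: closed_bigcup => [|u _]; [exact: finite_II|exact: closed_closed_ball_].
have : closure X `<=` \bigcup_(u in `I_k) closed_ball_ Num.norm (c u) rho.
  rewrite [X in _ `<=` X](closure_id _).1//; apply: closure_subset => x /Xc[u uk xu].
  by exists u.
by move=> /(_ y Xy)[u uk yu]; exists u.
Qed.

(** Covering by balls of radius [rho] costs at most a constant times the power [s - t] of [rho],
    which tends to [0]. *)
Lemma box_bounded_hausdorff_dim X (s t : R) : 0 < s -> t < s ->
  box_bounded X t -> (hausdorff_dim X <= s%:E)%E.
Proof.
move=> s0 ts [C [rho0 [C0 rho00 Xt]]].
have st : 0 < s - t by rewrite subr_gt0.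
suff Hd d : 0 < d -> hausdorff_premeasure s d X = 0%E.
  apply: ereal_inf_lbound; exists s => //=; split; first exact: ltW.
  apply/eqP; rewrite eq_le; apply/andP; split.
    by apply: ge_ereal_sup => _ [d /= d0 <-]; rewrite Hd.
  by apply: ereal_sup_ubound; exists 1 => //=; exact: Hd.
move=> d0; apply/eqP; rewrite eq_le hausdorff_premeasure_ge0 andbT.
apply/lee_addgt0Pr => e e0; rewrite add0e.
(* Here [n%:R * 2] converts a radius into a bound on the Euclidean diameter; adding [1] keeps [N]
   positive for [n = 0] too. *)
pose N : R := n%:R * 2 + 1.
have N0 : 0 < N by rewrite ltr_wpDl// mulr_ge0.
have D0 : 0 < C * N `^ s by rewrite mulr_gt0// powR_gt0.
pose x : R := (e / (C * N `^ s)) `^ (s - t)^-1.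
have x0 : 0 < x by rewrite powR_gt0// divr_gt0.
pose rho := Num.min rho0 (Num.min (d / N) x).
have rho_gt0 : 0 < rho by rewrite !lt_min rho00 x0 divr_gt0.
have rho_le : [&& rho <= rho0, rho <= d / N & rho <= x].
  by rewrite !ge_min !lexx !orbT.
move: rho_le => /and3P[rho_rho0 rho_dN rho_x].
have [|k [c [_ Xc kC]]] := Xt rho; first by rewrite rho_gt0.
have rho_d : N * rho <= d.
  rewrite mulrC -ler_pdivlMr// (le_trans (ge_min_r _ _))// ge_min_l//.
have n2N : n%:R * (2 * rho) <= N * rho by rewrite mulrA ler_wpM2r ?(ltW rho_gt0)// lerDl.
have XU : X `<=` \big[setU/set0]_(u <- iota 0 k) (X `&` closed_ball_ Num.norm (c u) rho).
  move=> y Xy; have [u uk yu] := Xc y Xy; rewrite -bigcup_seq; exists u => //=.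
  by rewrite mem_iota.
apply: le_trans (hausdorff_premeasure_bigcup s d XU) _.
apply: (@le_trans _ _ (\sum_(u <- iota 0 k) ((N * rho) `^ s)%:E)%E).
  apply: lee_sum => u _.
  apply: (@le_trans _ _ (((n%:R * (2 * rho)) `^ s)%:E)).
    apply: hausdorff_premeasure_le; rewrite ?(ltW s0) ?mulr_ge0 ?(ltW rho_gt0)//.
      exact: le_trans rho_d.
    move=> y z [_ yu] [_ zu]; rewrite -(subrK (c u) y) -addrA.
    apply: le_trans (ler_normD _ _) _; rewrite distrC mulr_natl mulr2n.
    exact: lerD.
  by rewrite lee_fin ge0_ler_powR ?nnegrE ?mulr_ge0 ?(ltW s0) ?(ltW rho_gt0) ?(ltW N0).
rewrite (sumEFin (iota 0 k) xpredT (fun=> (N * rho) `^ s)) lee_fin.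
rewrite big_const_seq count_predT size_iota iter_addr_0 -mulr_natl.
apply: (@le_trans _ _ (C * rho `^ (- t) * (N `^ s * rho `^ s))).
  by rewrite powRM ?(ltW N0) ?(ltW rho_gt0)// ler_wpM2r// mulr_ge0 ?powR_ge0.
have -> : C * rho `^ (- t) * (N `^ s * rho `^ s) = C * N `^ s * rho `^ (s - t).
  rewrite mulrACA -powRD 1?addrC//; apply/implyP => _; exact: lt0r_neq0.
rewrite mulrC -ler_pdivlMr//.
have -> : e / (C * N `^ s) = x `^ (s - t).
  by rewrite /x -powRrM mulVf ?gt_eqF// powRr1// ltW// divr_gt0.
by rewrite ge0_ler_powR ?nnegrE ?(ltW st) ?(ltW rho_gt0) ?(ltW x0).
Qed.

(** If the dimension exceeded [s > n], take [content_tree] with [branching_base] at [t = n]. The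
    words of length [i] are too few for their weights: their total tends to [0], yet it never falls
    below the positive weight of the root. *)
Lemma hausdorff_dim_le_ambient (K : set 'rV[R]_n) : (0 < n)%N -> compact K ->
  (hausdorff_dim K <= n%:R%:E)%E.
Proof.
move=> n0 Kc; apply/lee_addgt0Pr => e e0; rewrite -EFinD leNgt; apply/negP.
set s := n%:R + e; have nR : 0 < n%:R :> R by rewrite ltr0n.
have ns : (0 < n%:R :> R) && (n%:R < s) by rewrite nR ltrDl.
have s0 : 0 <= s by rewrite ltW// addr_gt0.
move=> /(hausdorff_dim_gt s0)[d d0 Kd].
have [b b1 qle] := branching_base n ns.
have b0 : (0 < b)%N by exact: ltnW.
pose a := d / n%:R; have a0 : 0 < a by rewrite divr_gt0.
have [c0 Hc0] := local_content b Kc a0 Kd.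
have nad : n%:R * a <= d by rewrite /a mulrC divfK ?gt_eqF.
have [good [h [[guniq _ h0 hgood hroot] [_ hle]]]] :=
  content_tree b0 a0 s0 nad Hc0.
set c := (n%:R * a) `^ s in hle; set beta := 2 ^+ n / b%:R `^ s in hle qle.
have c_gt0 : 0 <= c by exact: powR_ge0.
have beta0 : 0 <= beta by rewrite divr_ge0 ?powR_ge0 ?exprn_ge0.
have card_pool i : \sum_(v <- pool good i) 1 <= (b%:R ^+ n) ^+ i :> R.
  elim: i => [|i IH]; first by rewrite big_seq1.
  rewrite /= big_allpairs_dep exprS.
  apply: (@le_trans _ _ (\sum_(v <- pool good i) b%:R ^+ n)).
    apply: ler_sum => v _; rewrite big_const_seq count_predT iter_addr_0.
    rewrite -natrX ler_nat; have /card_uniqP <- := guniq v.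
    by rewrite (leq_trans (max_card _))// card_ffun !card_ord.
  by rewrite -[b%:R ^+ n]mulr1 -mulr_sumr mulr1 ler_wpM2l// exprn_ge0.
have small i : h [::] <= c * 2^-1 ^+ i.
  apply: le_trans (pool_mass hgood i) _.
  apply: (@le_trans _ _ (\sum_(v <- pool good i) c * beta ^+ i)).
    rewrite big_seq [leRHS]big_seq; apply: ler_sum => v vp.
    by rewrite -(size_pool vp).
  rewrite -[c * beta ^+ i]mulr1 -mulr_sumr -mulrA ler_wpM2l//.
  apply: (@le_trans _ _ (beta ^+ i * (b%:R ^+ n) ^+ i)).
    by rewrite ler_wpM2l// exprn_ge0.
  rewrite -exprMn lerXn2r// ?nnegrE ?mulr_ge0 ?exprn_ge0//.
  by move: qle; rewrite powR_mulrn.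
have cvg0 : c * 2^-1 ^+ i @[i --> \oo] --> c * 0.
  apply: cvgM; first exact: cvg_cst.
  by apply: cvg_expr; rewrite gtr0_norm// invf_lt1// ltr1n.
have : h [::] <= 0.
  rewrite -[leRHS](mulr0 c) -(cvg_lim _ cvg0)//; apply: limr_ge; first exact: cvgP cvg0.
  exact: nearW.
by rewrite leNgt hroot.
Qed.

End BoxDimension.

(** * Cantor dusts *)

Section CantorDust.
Variables (R : realType) (n : nat) (r : R).
Hypotheses (n_gt0 : (0 < n)%N) (r_gt0 : 0 < r) (r_lt : r < 2^-1).
Local Notation E := {ffun 'I_n -> bool}.

(** Each level consists of preimages under the inverses of the two contractions, so closedness
    follows from continuity. *)
Fixpoint cantor_level (k : nat) : set R :=
  if k is k'.+1 then
    [set x | cantor_level k' (x / r) \/ cantor_level k' ((x - (1 - r)) / r)]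
  else [set x | 0 <= x <= 1].

Definition cantor_line : set R := [set x | forall k, cantor_level k x].

Definition cantor_dust : set 'rV[R]_n := [set x | forall i, cantor_line (x 0 i)].

Definition dust_map (e : E) (x : 'rV[R]_n) : 'rV[R]_n :=
  \row_i (r * x 0 i + (1 - r) * (e i)%:R).

Lemma cantor_level_itv k x : cantor_level k x -> 0 <= x <= 1.
Proof.
have r0 := r_gt0; have r2 := r_lt.
elim: k x => //= k IH x [/IH|/IH]; rewrite ler_pdivlMr// ler_pdivrMr// mul0r => /andP[? ?];
  by apply/andP; split; lra.
Qed.

Lemma cantor_lineE x :
  cantor_line x <-> cantor_line (x / r) \/ cantor_line ((x - (1 - r)) / r).
Proof.
have r0 := r_gt0; have r2 := r_lt.
split=> [xC|[xC|xC] [|k]].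
(* The same alternative must hold at all levels; since [r < 1 - r], comparing [x] with [r] decides
   it. *)
- have side k : cantor_level k.+1 x -> if x <= r then cantor_level k (x / r)
      else cantor_level k ((x - (1 - r)) / r).
    case: ifP => [xr|/negbT + ] [] //.
      move=> /cantor_level_itv/andP[]; rewrite ler_pdivlMr// mul0r; lra.
    rewrite -ltNge => xr /cantor_level_itv/andP[_]; rewrite ler_pdivrMr//; lra.
  by case: (x <= r) side => side; [left|right] => k; exact: (side k (xC k.+1)).
- by apply: (@cantor_level_itv 1%N); left; exact: (xC 0%N).
- by left; exact: xC.
- by apply: (@cantor_level_itv 1%N); right; exact: (xC 0%N).
- by right; exact: xC.
Qed.

Lemma cantor_line0 : cantor_line 0.
Proof.
by elim=> [|k IH] /=; [rewrite lexx ler01 | left; rewrite mul0r].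
Qed.

Lemma cantor_level_closed k : closed (cantor_level k).
Proof.
elim: k => [|k IH] /=.
  by have := @itv_closed _ R 0 1; rewrite set_itvcc.
apply: (@closedU _ [set x | cantor_level k (x / r)]
                   [set x | cantor_level k ((x - (1 - r)) / r)]).
  apply: (continuous_closedP _).1 IH => x.
  by apply: cvgM; [exact: cvg_id|exact: cvg_cst].
apply: (continuous_closedP (fun x : R => (x - (1 - r)) / r)).1 IH => x.
apply: cvgM; last exact: cvg_cst.
by apply: cvgB; [exact: cvg_id|exact: cvg_cst].
Qed.

Lemma cantor_dust_compact : compact cantor_dust.
Proof.
apply: (@rV_compact _ n (fun=> cantor_line)) => _.
apply: (subclosed_compact _ (@segment_compact R 0 1)); last first.
  by move=> x xC; have := xC 0%N; rewrite set_itvcc.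
have -> : cantor_line = \bigcap_k cantor_level k.
  by apply/seteqP; split=> [x xC k _|x xC k]; [exact: xC|exact: (xC k I)].
by apply: closed_bigI => k _; exact: cantor_level_closed.
Qed.

Lemma cantor_dust0 : cantor_dust 0.
Proof. by move=> i; rewrite mxE; exact: cantor_line0. Qed.

Lemma cantor_dust_dist x y : cantor_dust x -> cantor_dust y -> `|x - y| <= 1.
Proof.
move=> xS yS; apply: norm_le_coord => // i; rewrite !mxE ler_norml.
have /andP[? ?] := xS i 0%N; have /andP[? ?] := yS i 0%N.
by apply/andP; split; lra.
Qed.

Lemma dust_map_dust e x : cantor_dust x -> cantor_dust (dust_map e x).
Proof.
move=> xS i; rewrite mxE; apply/cantor_lineE.
have r0 := r_gt0.
case: (e i); [right|left]; rewrite ?mulr1 ?mulr0 ?addr0 ?addrK mulrAC.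
  by rewrite divff ?gt_eqF// mul1r; exact: xS.
by rewrite divff ?gt_eqF// mul1r; exact: xS.
Qed.

Lemma dust_mapP y : cantor_dust y -> exists e x, cantor_dust x /\ y = dust_map e x.
Proof.
move=> yS; have r0 := r_gt0.
have /choice[g gP] : forall i, exists z : bool * R, cantor_line z.2 /\
    y 0 i = r * z.2 + (1 - r) * (z.1)%:R.
  move=> i; have /cantor_lineE[h|h] := yS i.
    exists (false, y 0 i / r); split=> //=.
    by rewrite mulr0 addr0 mulrC divfK ?gt_eqF.
  exists (true, (y 0 i - (1 - r)) / r); split=> //=.
  by rewrite mulr1 [r * _]mulrC divfK ?gt_eqF// subrK.
exists [ffun i => (g i).1], (\row_i (g i).2); split.
  by move=> i; rewrite mxE; exact: (gP i).1.
by apply/rowP => i; rewrite !mxE ffunE; exact: (gP i).2.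
Qed.

Lemma dust_map_sub e x y : dust_map e x - dust_map e y = r *: (x - y).
Proof. by apply/rowP => i; rewrite !mxE; lra. Qed.

Lemma dust_map_similarity e : similarity r (dust_map e).
Proof.
move=> x y; rewrite /eucl_dist -[X in _ = X * _]ger0_norm ?(ltW r_gt0)//.
rewrite -sqrtr_sqr -sqrtrM ?sqr_ge0//; congr Num.sqrt.
by rewrite mulr_sumr; apply: eq_bigr => i _; rewrite !mxE; ring.
Qed.

(** In a coordinate where [e] and [e'] differ, one image lies in [[0, r]] and the other in
    [[1 - r, 1]]. *)
Lemma dust_map_gap e e' x y : e != e' -> cantor_dust x -> cantor_dust y ->
  1 - 2 * r <= `|dust_map e x - dust_map e' y|.
Proof.
have r0 := r_gt0.
move=> ee' xS yS; have /forallPn[i ei] : ~~ [forall i, e i == e' i].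
  by apply: contra ee' => /forallP h; apply/eqP/ffunP => i; exact: (eqP (h i)).
apply: le_trans (norm_coord_le _ i); rewrite !mxE.
have /andP[x0 x1] := xS i 0%N; have /andP[y0 y1] := yS i 0%N.
have := ler_wpM2l (ltW r0) x1; have := ler_wpM2l (ltW r0) y1.
have := mulr_ge0 (ltW r0) x0; have := mulr_ge0 (ltW r0) y0.
move: ei; case: (e i); case: (e' i) => //= _.
  by move=> *; apply: le_trans (ler_norm _); lra.
by move=> *; rewrite distrC; apply: le_trans (ler_norm _); lra.
Qed.

Lemma cantor_dust_self_similar : homogeneous_self_similar_SSC cantor_dust.
Proof.
exists #|{: E}|, (fun i => dust_map (enum_val i)); split.
- split.
  + by exists 0; exact: cantor_dust0.
  + exact: cantor_dust_compact.
  + move=> i; exists r; split; last exact: dust_map_similarity.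
    by rewrite r_gt0 (lt_trans r_lt)// invf_lt1// ltr1n.
  + apply/seteqP; split=> [y /dust_mapP[e [x [xS ->]]]|_ [i _ [x xS <-]]].
      by exists (enum_rank e) => //; exists x => //; rewrite enum_rankK.
    exact: dust_map_dust.
- by exists r => i; exact: dust_map_similarity.
- move=> i j ij; apply/seteqP; split=> // z [[x xS <-] [y yS]].
  move=> /esym xy; have ee : enum_val i != enum_val j.
    by rewrite (inj_eq enum_val_inj) -val_eqE /= ltn_eqF.
  have := dust_map_gap ee xS yS; rewrite xy subrr normr0.
  by move=> h; have := r_lt; lra.
Qed.

(** * Dimension of the dust, with [r_s] as Moran's equation for [2 ^+ n] maps of ratio [r] *)

Variable s : R.
Hypotheses (s_gt0 : 0 < s) (r_s : 2 ^+ n * r `^ s = 1).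

Lemma cantor_dust_net k : exists l : seq 'rV[R]_n,
  [/\ size l = ((2 ^ n) ^ k)%N, forall x, x \in l -> cantor_dust x &
    forall y, cantor_dust y -> exists2 x, x \in l & `|x - y| <= r ^+ k].
Proof.
elim: k => [|k [l [sl lS lc]]].
  exists [:: 0]; split=> //= [x|y yS].
    by rewrite inE => /eqP ->; exact: cantor_dust0.
  by exists 0; [rewrite inE|exact: cantor_dust_dist cantor_dust0 yS].
exists [seq dust_map e x | e <- enum {: E}, x <- l]; split.
- by rewrite size_allpairs sl -cardE card_ffun card_bool card_ord expnS.
- by move=> _ /allpairsP[[e x] /= [_ /lS xS ->]]; exact: dust_map_dust.
- move=> _ /dust_mapP[e [y [/lc[x xl xy] ->]]]; exists (dust_map e x).
    by apply/allpairsP; exists (e, x); rewrite mem_enum.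
  rewrite dust_map_sub normrZ gtr0_norm// exprS.
  by rewrite ler_wpM2l ?(ltW r_gt0).
Qed.

Lemma cantor_dust_box_bounded : box_bounded cantor_dust s.
Proof.
have r0 := r_gt0.
have r1 : r < 1 by rewrite (lt_trans r_lt)// invf_lt1// ltr1n.
exists (2 ^+ n), 1; split=> //.
move=> rho /andP[rho0 rho1].
have exk : exists k, r ^+ k <= rho.
  have : r ^+ k @[k --> \oo] --> 0 by apply: cvg_expr; rewrite gtr0_norm.
  move=> /cvgrPdist_le/(_ _ rho0)[k _ /(_ k (leqnn k))] /=.
  by rewrite sub0r normrN ger0_norm ?exprn_ge0 ?(ltW r0)//; exists k.
(* By minimality [r * rho <= r ^+ k], so the [(2 ^ n) ^ k] net points exceed the power [- s] of
   [rho] by a factor of at most [2 ^+ n]. *)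
case: (ex_minnP exk) => k rk kmin.
have [l [sl lS lc]] := cantor_dust_net k.
exists (size l), (nth 0 l); split.
- by move=> u ul; apply: lS; exact: mem_nth.
- move=> y /lc[x xl xy]; exists (index x l); first by rewrite index_mem.
  by rewrite nth_index// (le_trans xy).
rewrite sl.
have rk2 : r * rho <= r ^+ k.
  case: (k) kmin => [_|k' kmin]; first by rewrite expr0 mulr_ile1 ?(ltW r0) ?(ltW rho0) ?(ltW r1).
  rewrite exprS ler_wpM2l ?(ltW r0)// ltW// ltNge; apply/negP => /kmin.
  by rewrite ltnn.
have rs0 : 0 < r `^ s by rewrite powR_gt0.
have twoE : 2 ^+ n = (r `^ s)^-1 :> R.
  by apply: (mulIf (lt0r_neq0 rs0)); rewrite r_s mulVf ?gt_eqF.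
rewrite 2!natrX twoE powRN -invfM exprVn lef_pV2 ?posrE ?mulr_gt0 ?powR_gt0 ?exprn_gt0//.
rewrite -powRM ?(ltW r0) ?(ltW rho0)// -powR_mulrn ?powR_ge0// powRAC powR_mulrn ?(ltW r0)//.
by rewrite ge0_ler_powR ?(ltW s_gt0) ?nnegrE ?mulr_ge0 ?exprn_ge0 ?(ltW r0) ?(ltW rho0).
Qed.

(* Induction on the number of sets: sets of diameter less than the gap [1 - 2 r]
   meet a single piece of the dust, the sets meeting the cheapest piece are fewer,
   and pulling them back by the similarity gives a cheaper cover of the dust. *)
Lemma cantor_dust_finite_cover (s' : R) (l : seq nat) (U : nat -> set 'rV[R]_n)
    (d : nat -> R) : 0 <= s' <= s ->
  (forall i, 0 <= d i) ->
  (forall i x y, U i x -> U i y -> `|x - y| <= d i) ->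
  (forall x, cantor_dust x -> exists2 i, i \in l & U i x) ->
  (1 - 2 * r) `^ s' <= \sum_(i <- l) d i `^ s'.
Proof.
move=> /andP[s'0 s's]; have r0 := r_gt0.
have gap0 : 0 < 1 - 2 * r by have := r_lt; lra.
have [N] := ubnP (size l); elim: N l U d => // N IH l U d.
rewrite ltnS => lN d0 Ud cov; rewrite leNgt; apply/negP => lt.
(* A set as large as the gap would give the bound on its own. *)
have d_small i : i \in l -> d i < 1 - 2 * r.
  move=> il; rewrite ltNge; apply/negP => h.
  move: lt; rewrite ltNge (big_rem i)//= => /negP; apply.
  apply: (@le_trans _ _ (d i `^ s')); last first.
    by rewrite lerDl sumr_ge0// => j _; exact: powR_ge0.
  by rewrite ge0_ler_powR// nnegrE// ltW.
pose meets (e : E) i := `[< exists x, cantor_dust x /\ U i (dust_map e x) >].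
have meets1 e e' i : i \in l -> meets e i -> meets e' i -> e = e'.
  move=> il /asboolP[x [xS xU]] /asboolP[y [yS yU]]; apply/eqP.
  rewrite -[_ == _]negbK; apply/negP => ee'.
  have := dust_map_gap ee' xS yS; rewrite leNgt => /negP; apply.
  exact: le_lt_trans (Ud _ _ _ xU yU) (d_small i il).
have [e he] : exists e : E,
    \sum_(i <- l | meets e i) d i `^ s' < (1 - 2 * r) `^ s' / 2 ^+ n.
  apply: contrapT => noe; move: lt; rewrite ltNge => /negP; apply.
  apply: (@le_trans _ _ (\sum_(e : E) \sum_(i <- l | meets e i) d i `^ s')).
    apply: (@le_trans _ _ (\sum_(e : E) (1 - 2 * r) `^ s' / 2 ^+ n)).
      by rewrite sumr_const card_ffun card_bool card_ord -[leRHS]mulr_natr natrX divfK.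
    by apply: ler_sum => e _; rewrite leNgt; apply/negP => h; apply: noe; exists e.
  rewrite (exchange_big_dep xpredT)//= big_seq [leRHS]big_seq.
  apply: ler_sum => i il.
  have [[e me]|nome] := pselect (exists e, meets e i).
    rewrite (bigD1 e)//= big1 ?addr0// => e' /andP[me' /eqP]; case.
    exact: meets1 il me' me.
  by rewrite big1 ?powR_ge0// => e me; case: nome; exists e.
pose l' := [seq i <- l | meets e i].
have rs'0 : 0 < r `^ s' by rewrite powR_gt0.
have : (1 - 2 * r) `^ s' <= \sum_(i <- l') (d i / r) `^ s'.
  apply: (IH l' (fun i => [set x | U i (dust_map e x)])).
  - apply: leq_trans lN; rewrite size_filter -(count_predC (meets e) l).
    rewrite -[X in (X < _)%N]addn0 ltn_add2l -has_count.
    (* A set covering a point of another piece cannot meet the piece of [e], so [l'] is strictly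
       shorter than [l]. *)
    pose e' : E := [ffun i => ~~ e i].
    have ee' : e != e'.
      apply/eqP => /ffunP/(_ (Ordinal n_gt0)); rewrite ffunE.
      by case: (e _).
    have [i il iU] := cov _ (dust_map_dust e' cantor_dust0).
    apply/hasP; exists i => //=; apply/negP => me.
    have me' : meets e' i.
      by apply/asboolP; exists 0; split=> //; exact: cantor_dust0.
    by move: ee'; rewrite (meets1 _ _ _ il me me') eqxx.
  - by move=> i; rewrite divr_ge0// ltW.
  - move=> i x y /= /Ud xU /xU; rewrite dust_map_sub normrZ gtr0_norm// => h.
    by rewrite ler_pdivlMr// mulrC.
  - move=> x xS; have [i il iU] := cov _ (dust_map_dust e xS).
    by exists i => //; rewrite mem_filter il andbT; apply/asboolP; exists x.
rewrite leNgt => /negP; apply; rewrite big_filter.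
under eq_bigr do rewrite powRM ?d0 ?invr_ge0 ?(ltW r0)// -powR_inv1 ?(ltW r0)//
  -powRrM mulN1r powRN.
rewrite -mulr_suml ltr_pdivrMr//; apply: (lt_le_trans he).
rewrite ler_wpM2l ?powR_ge0//.
have n2 : 2 ^+ n != 0 :> R by rewrite expf_neq0.
have -> : (2 ^+ n)^-1 = r `^ s by apply: (mulfI n2); rewrite r_s divff.
rewrite ger_powR//; apply/andP; split=> //.
by rewrite ltW// (lt_trans r_lt)// invf_lt1// ltr1n.
Qed.

Lemma powR_room (x p e : R) : 0 <= x -> 0 <= p -> 0 < e ->
  exists2 y, x < y & y `^ p <= x `^ p + e.
Proof.
move=> x0; rewrite le_eqVlt => /predU1P[<-|p0] e0.
  by exists (x + 1); rewrite ?ltrDl// !powRr0 lerDl ltW.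
exists ((x `^ p + e) `^ p^-1).
  rewrite -[ltLHS](@powRr1 _ x)// -(divff (lt0r_neq0 p0)) powRrM.
  by rewrite gt0_ltr_powR ?invr_gt0 ?nnegrE ?addr_ge0 ?powR_ge0 ?ltrDl// ltW.
by rewrite -powRrM mulVf ?gt_eqF// powRr1// addr_ge0 ?powR_ge0// ltW.
Qed.

(** Each set of the cover is enlarged to an open one at cost at most [e / 2 ^+ i.+1]; compactness
    then reduces the claim to finite covers. *)
Lemma cantor_dust_premeasure (s' d : R) : 0 <= s' <= s ->
  (((1 - 2 * r) `^ s')%:E <= hausdorff_premeasure s' d cantor_dust)%E.
Proof.
move=> s's; have s'0 : 0 <= s' by case/andP: s's.
apply: le_ereal_inf_tmp => _ [U [SU Ud] <-].
apply/lee_addgt0Pr => e e0.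
pose w i := e / 2 ^+ i.+1.
have w0 i : 0 < w i by rewrite divr_gt0// exprn_gt0.
have w_sum N : \sum_(0 <= i < N) w i <= e.
  suff -> : \sum_(0 <= i < N) w i = e - e / 2 ^+ N.
    by rewrite lerBlDl lerDr divr_ge0 ?exprn_ge0 ?ltW.
  elim: N => [|N IH]; first by rewrite big_geq// expr0 divr1 subrr.
  rewrite big_nat_recr//= IH /w exprS; field.
  by rewrite expf_neq0.
have diam_fin i : U i !=set0 -> exists2 a : R, 0 <= a & diam (U i) = a%:E.
  move=> Ui; have := diam_ge0 Ui; have := Ud i.
  by case: (diam (U i)) => // a _ a0; exists a.
have /choice[D DP] : forall i, exists y : R, 0 <= y /\ (U i !=set0 ->
    (diam (U i) < y%:E)%E /\ ((y `^ s')%:E <= hausdorff_gauge s' (U i) + (w i)%:E)%E).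
  move=> i; have [Ui|?] := pselect (U i !=set0); last by exists 0.
  have [a a0 aE] := diam_fin i Ui; have [y ay ya] := powR_room a0 s'0 (w0 i).
  exists y; split; first by rewrite (le_trans a0)// ltW.
  move=> _; rewrite aE lte_fin; split=> //.
  by rewrite /hausdorff_gauge (negPf ((set0P _).2 Ui)) aE -EFinD lee_fin.
(* Fattening by half of the excess keeps mutual distances in [V i] at most [D i]. *)
pose eta i := (D i - fine (diam (U i))) / 2.
pose V i := \bigcup_(y in U i) ball y (eta i).
have eta0 i : U i !=set0 -> 0 < eta i.
  move=> Ui; have [a a0 aE] := diam_fin i Ui.
  rewrite divr_gt0// subr_gt0 aE /= -lte_fin -aE.
  by have [_ /(_ Ui)[]] := DP i.
have Vdist i x y : V i x -> V i y -> `|x - y| <= D i.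
  move=> [x' Ux xx'] [y' Uy yy'].
  have Ui : U i !=set0 by exists x'.
  have [a a0 aE] := diam_fin i Ui.
  have h : `|x' - y'| <= a.
    by rewrite (le_trans (norm_le_eucl _ _))// -lee_fin -aE eucl_le_diam.
  have -> : D i = eta i + (a + eta i) by rewrite /eta aE /=; lra.
  have -> : x - y = - (x' - x) + ((x' - y') + (y' - y)).
    by rewrite opprB addrA subrKA addrA subrK.
  move: xx' yy'; rewrite -!ball_normE /= => xx' yy'.
  apply: le_trans (ler_normD _ _) _; rewrite normrN; apply: lerD; first exact: ltW.
  by apply: le_trans (ler_normD _ _) _; apply: lerD => //; exact: ltW.
have := cantor_dust_compact; rewrite compact_cover => Sc.
have [|x xS|F _ SF] := Sc nat setT V.
- by move=> i _; apply: bigcup_open => y Uy; exact: ball_open.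
- have [i _ Ui] := SU x xS; exists i => //; exists x => //.
  by apply: ballxx; apply: eta0; exists x.
pose N := (\max_(i <- finmap.enum_fset F) i).+1.
pose l := [seq i <- iota 0 N | U i != set0].
have := @cantor_dust_finite_cover s' l V D s's (fun i => (DP i).1) Vdist.
have cov x : cantor_dust x -> exists2 i, i \in l & V i x.
  move=> /SF[i iF Vi]; exists i => //; rewrite mem_filter mem_iota add0n ltnS.
  rewrite leq_bigmax_seq//= andbT; apply/set0P; case: Vi => y Uy _.
  by exists y.
move=> /(_ cov); rewrite -lee_fin => /le_trans; apply.
rewrite -sumEFin big_filter.
apply: (@le_trans _ _ (\sum_(i <- iota 0 N | U i != set0)
   (hausdorff_gauge s' (U i) + (w i)%:E))%E).
  by apply: lee_sum => i /set0P Ui; have [_ /(_ Ui)[]] := DP i.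
apply: (@le_trans _ _ (\sum_(0 <= i < N)
   (hausdorff_gauge s' (U i) + (w i)%:E))%E).
  rewrite big_mkcond /index_iota subn0; apply: lee_sum => i _; case: ifP => // _.
  by rewrite adde_ge0 ?hausdorff_gauge_ge0 ?lee_fin ?(ltW (w0 i)).
rewrite big_split/= leeD//; last by rewrite sumEFin lee_fin.
by apply: nneseries_lim_ge => i _ _; exact: hausdorff_gauge_ge0.
Qed.

Lemma cantor_dust_dim : hausdorff_dim cantor_dust = s%:E.
Proof.
apply/eqP; rewrite eq_le; apply/andP; split.
  apply/lee_addgt0Pr => e e0; rewrite -EFinD.
  by apply: box_bounded_hausdorff_dim cantor_dust_box_bounded; rewrite ?addr_gt0// ltrDl.
apply: le_ereal_inf_tmp => _ [s' [s'0 Hs'] <-]; rewrite lee_fin leNgt.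
apply/negP => s's; suff : (0 < hausdorff_measure s' cantor_dust)%E by rewrite Hs' ltxx.
have h : 0 <= s' <= s by rewrite s'0 ltW.
apply: (@lt_le_trans _ _ ((1 - 2 * r) `^ s')%:E).
  by rewrite lte_fin powR_gt0//; have := r_lt; lra.
apply: le_trans (cantor_dust_premeasure 1 h) _.
by apply: ereal_sup_ubound; exists 1 => //=.
Qed.

End CantorDust.

Lemma self_similar_of_dim (R : realType) (n : nat) (s : R) : 0 < s < n%:R ->
  exists S : set 'rV[R]_n, [/\ homogeneous_self_similar_SSC S, compact S,
    S !=set0, hausdorff_dim S = s%:E & box_bounded S s].
Proof.
move=> /andP[s0 sn]; have nR := lt_trans s0 sn.
have n0 : (0 < n)%N by rewrite -(ltr0n R).
(* The solution of Moran's equation; [s < n] is what makes it smaller than one half. *)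
pose r : R := 2 `^ (- (n%:R / s)).
have r0 : 0 < r by rewrite powR_gt0.
have r2 : r < 2^-1.
  rewrite /r powRN ltf_pV2 ?posrE ?powR_gt0//.
  have ns : 0 < n%:R / s - 1 by rewrite subr_gt0 ltr_pdivlMr// mul1r.
  rewrite -(subrKC 1 (n%:R / s)) powRD; last by apply/implyP => _; exact: lt0r_neq0.
  rewrite powRr1// ltr_pMr//.
  apply: (@le_lt_trans _ _ (1 `^ (n%:R / s - 1))); first by rewrite powR1.
  by rewrite gt0_ltr_powR// ?nnegrE// ltr1n.
have rs : 2 ^+ n * r `^ s = 1.
  by rewrite /r -powRrM mulNr divfK ?gt_eqF// powRN powR_mulrn// divff.
exists (@cantor_dust R n r); split.
- exact: cantor_dust_self_similar.
- exact: cantor_dust_compact.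
- by exists 0; exact: cantor_dust0.
- exact: cantor_dust_dim.
- exact: cantor_dust_box_bounded.
Qed.

(** * Dimension-like functions *)

Section NaturalDimension.
Variables (R : realType) (n : nat) (D : set 'rV[R]_n -> R).
Hypotheses (n_gt0 : (0 < n)%N)
  (D_range : forall K, compact K -> 0 <= D K <= n%:R)
  (D_lipschitz : forall (K : set 'rV[R]_n) (f : 'rV[R]_n -> 'rV[R]_n),
     compact K -> eucl_lipschitz_on K f -> D (f @` K) <= D K)
  (D_monotone : forall A B : set 'rV[R]_n,
     compact A -> compact B -> A `<=` B -> D A <= D B)
  (D_self_similar : forall S : set 'rV[R]_n,
     homogeneous_self_similar_SSC S -> (D S)%:E = hausdorff_dim S).

Lemma dimension_le_of_dim_gt (A B : set 'rV[R]_n) (s t : R) :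
  compact A -> compact B -> 0 < t < s -> (s%:E < hausdorff_dim A)%E ->
  box_bounded B t -> D B <= D A.
Proof.
move=> Ac Bc ts sA Bt; have s0 : 0 <= s by case/andP: ts => t0 ts; rewrite ltW// (lt_trans t0).
have [d d0 Ad] := hausdorff_dim_gt s0 sA.
have [A' [f [A'c A'A <- [L fL]]]] := lipschitz_onto n_gt0 Ac Bc ts d0 Ad Bt.
apply: le_trans (D_monotone A'c Ac A'A); apply: D_lipschitz => //.
(* The factor [n] passes from the maximum norm to the Euclidean distance; the absolute value covers
   a possibly negative [L]. *)
exists (n%:R * `|L|) => x y A'x A'y; apply: (le_trans (eucl_le_norm _ _)).
rewrite -mulrA ler_wpM2l//; apply: (le_trans (fL _ _ A'x A'y)).
apply: (@le_trans _ _ (`|L| * `|x - y|)); first by rewrite ler_wpM2r// ler_norm.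
by rewrite ler_wpM2l// norm_le_eucl.
Qed.

(** Otherwise a dust with dimension strictly between [D K] and the Hausdorff dimension of [K] is a
    Lipschitz image of a compact part of [K], yet has larger [D]. *)
Lemma dimension_ge_hausdorff K : compact K -> (hausdorff_dim K <= (D K)%:E)%E.
Proof.
move=> Kc; rewrite leNgt; apply/negP => DK.
have /andP[DK0 DKn] := D_range Kc.
have dimn := hausdorff_dim_le_ambient n_gt0 Kc.
have [dimE dimE2] : exists a : R, hausdorff_dim K = a%:E.
  case: (hausdorff_dim K) DK dimn => // a _ _; by exists a.
move: DK dimn; rewrite dimE2 lte_fin lee_fin => DK dimn.
pose s := (2 * D K + dimE) / 3; pose s' := (D K + 2 * dimE) / 3.
have s0n : 0 < s < n%:R by apply/andP; split; rewrite /s; lra.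
have [S [Sss Sc _ Sdim Sbox]] := self_similar_of_dim s0n.
have : D S <= D K.
  apply: (dimension_le_of_dim_gt (s := s') Kc Sc _ _ Sbox).
    by apply/andP; split; rewrite /s /s'; lra.
  by rewrite dimE2 lte_fin /s'; lra.
have := D_self_similar Sss; rewrite Sdim => -[->].
by rewrite leNgt => /negP; apply; rewrite /s; lra.
Qed.

(** The roles are exchanged: a dust with dimension strictly between [t] and [D K] would dominate
    [K]. *)
Lemma dimension_le_box K (t : R) : compact K -> 0 < t -> box_bounded K t -> D K <= t.
Proof.
move=> Kc t0 Kt; rewrite leNgt; apply/negP => tD.
have /andP[_ Dn] := D_range Kc.
pose s := (2 * t + D K) / 3; pose s' := (t + 2 * D K) / 3.
have s0n : 0 < s' < n%:R by apply/andP; split; rewrite /s'; lra.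
have [S [Sss Sc _ Sdim _]] := self_similar_of_dim s0n.
have : D K <= D S.
  apply: (dimension_le_of_dim_gt (s := s) Sc Kc _ _ Kt).
    by rewrite t0 /s; lra.
  by rewrite Sdim lte_fin /s /s'; lra.
have := D_self_similar Sss; rewrite Sdim => -[->].
by rewrite leNgt => /negP; apply; rewrite /s'; lra.
Qed.

(** Stated for [X] and its closure because the pieces of a packing decomposition may fail to be
    compact. *)
Lemma dimension_closure_le (X : set 'rV[R]_n) : compact (closure X) ->
  ((D (closure X))%:E <= upper_box_dim X)%E.
Proof.
move=> Xc; have [X0|/set0P X0] := eqVneq X set0.
  rewrite X0 closure0 /upper_box_dim eqxx lee_fin leNgt; apply/negP => D0.
  have c0 : compact (set0 : set 'rV[R]_n) by exact: compact0.
  have /andP[_ Dn] := D_range c0.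
  (* The empty set lies in a dust of dimension [s], so monotonicity contradicts [D set0 > s]. *)
  pose s := D set0 / 2.
  have s0n : 0 < s < n%:R by apply/andP; split; rewrite /s; lra.
  have [S [Sss Sc _ Sdim _]] := self_similar_of_dim s0n.
  have := D_self_similar Sss; rewrite Sdim => -[DS].
  by have := D_monotone c0 Sc (@sub0set _ _); rewrite DS /s; lra.
rewrite leNgt; apply/negP => h.
have /andP[D0 _] := D_range Xc.
have u0 := upper_box_dim_ge0 X.
have [u uE] : exists u : R, upper_box_dim X = u%:E.
  by case: (upper_box_dim X) h u0 => // u _ _; exists u.
move: h u0; rewrite uE lte_fin lee_fin => h u0.
pose t := (u + D (closure X)) / 2.
have Xt : box_bounded X t.
  by apply: upper_box_dim_lt => //; rewrite uE lte_fin /t; lra.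
have := dimension_le_box Xc _ (box_bounded_closure Xt).
by rewrite /t => H; have := H ltac:(lra); lra.
Qed.

End NaturalDimension.

Theorem corollary1p9 (R : realType) (n : nat) (n_gt0 : (0 < n)%N)
  (* only the values of D on compact sets matter *)
  (D : set 'rV[R]_n -> R)
  (D_range : forall K, compact K -> 0 <= D K <= n%:R)
  (D_lipschitz : forall (K : set 'rV[R]_n) (f : 'rV[R]_n -> 'rV[R]_n),
     compact K -> eucl_lipschitz_on K f -> D (f @` K) <= D K)
  (D_monotone : forall A B : set 'rV[R]_n,
     compact A -> compact B -> A `<=` B -> D A <= D B)
  (D_self_similar : forall S : set 'rV[R]_n,
     homogeneous_self_similar_SSC S -> (D S)%:E = hausdorff_dim S) :
  (forall K : set 'rV[R]_n, compact K ->
     (hausdorff_dim K <= (D K)%:E)%E /\ ((D K)%:E <= upper_box_dim K)%E) /\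
  ((forall F : nat -> set 'rV[R]_n,
      (forall i, compact (F i)) -> compact (\bigcup_i F i) ->
      (D (\bigcup_i F i))%:E = ereal_sup (range (fun i => (D (F i))%:E))) ->
   forall K : set 'rV[R]_n, compact K ->
     (hausdorff_dim K <= (D K)%:E)%E /\ ((D K)%:E <= packing_dim K)%E).
Proof.
have compactE (K : set 'rV[R]_n) : compact K -> closure K = K.
  by move=> /(compact_closed (@norm_hausdorff _ _))/closure_id.
have lower := dimension_ge_hausdorff n_gt0 D_range D_lipschitz D_monotone D_self_similar.
have upper := dimension_closure_le n_gt0 D_range D_lipschitz D_monotone D_self_similar.
split=> [K Kc|D_sigma K Kc].
  split; first exact: lower.
  by have := upper K; rewrite compactE//; apply.
split; first exact: lower.
apply: le_ereal_inf_tmp => _ [F [KF Fb] <-].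
(* [K] is closed, so the closures of the pieces stay inside it and form a compact decomposition to
   which [D_sigma] applies. *)
have Fcl i : closure (F i) `<=` K.
  rewrite -[X in _ `<=` X]compactE// KF; apply: closure_subset.
  exact: bigcup_sup.
have Fc i : compact (closure (F i)).
  by apply: (subclosed_compact _ Kc (Fcl i)); exact: closed_closure.
have KE : K = \bigcup_i closure (F i).
  apply/seteqP; split=> [x|x [i _ /Fcl]//].
  by rewrite {1}KF => -[i _ Fx]; exists i => //; exact: subset_closure.
rewrite {1}KE D_sigma//; last by rewrite -KE.
apply: ge_ereal_sup => _ [i _ <-]; apply: (le_trans (upper _ (Fc i))).
by apply: ereal_sup_ubound; exists i.
Qed.
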